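(* Let $\mathbf{c}=(c_1,\dots,c_n)\in\mathbb{Z}_{>0}^n$ and $0<k<c_1+\cdots+c_n$. For each $0\le i\le n$, the coefficient $[x^i]h^*(\mathscr{R}_{k,\mathbf{c}},x)$ equals the number of $\mathbf{c}$-compatible decorated ordered set partitions of type $(k,n)$ having winding number $i$.
   Context: $\mathscr{R}_{k,\mathbf{c}}=\{x\in\mathbb{R}^n : 0\le x_i\le c_i,\ \sum_i x_i=k\}$, an $(n-1)$-dimensional lattice polytope. For a lattice polytope $\mathscr{P}$ of dimension $d$ with Ehrhart polynomial $\operatorname{ehr}(\mathscr{P},t)$ (so $\operatorname{ehr}(\mathscr{P},t)=\#(t\mathscr{P}\cap\mathbb{Z}^n)$ for $t\ge1$ and $\operatorname{ehr}(\mathscr{P},0)=1$), the $h^*$-polynomial is defined by $\sum_{j\ge0}\operatorname{ehr}(\mathscr{P},j)x^j=h^*(\mathscr{P},x)/(1-x)^{d+1}$. A cyclically ordered partition of $[n]$ is a sequence $(L_1,\dots,L_m)$ of nonempty pairwise disjoint blocks with union $[n]$, considered up to cyclic rotation. A decorated ordered set partition of type $(k,n)$ is a cyclically ordered partition $\xi=(L_1,\dots,L_m)$ of $[n]$ together with a map $w$ from its blocks to $\mathbb{Z}_{>0}$ with $\sum_{j}w(L_j)=k$. It is $\mathbf{c}$-compatible if $w(L)<\sum_{i\in L}c_i$ for every block $L$. Winding number: place the blocks on $k$ points $0,1,\dots,k-1$ of a circle (read modulo $k$, clockwise), putting $L_j$ at position $p(L_j)=w(L_1)+\cdots+w(L_{j-1})\pmod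 k$; for $i\in[n]$ let $\lambda_i\in\{0,\dots,k-1\}$ be the clockwise distance $p(\text{block containing } i+1)-p(\text{block containing } i)\pmod k$, where $n+1$ is read as $1$. Then $\lambda_1+\cdots+\lambda_n=dk$ for a unique integer $d$, called the winding number (independent of the choice of the first block). *)

(* Defs.v *)
From HB Require Import structures.
From mathcomp Require Import all_boot all_order all_algebra finmap.

Set Implicit Arguments.
Unset Strict Implicit.
Unset Printing Implicit Defensive.

(* A sequence of pairs (block, weight).  The bounds (at most [n] blocks,
   weights at most [k]) only make the type finite: they hold for every
   sequence of disjoint nonempty blocks in [n] whose weights sum to [k]. *)
Notation weighted_block n k := ({set 'I_n} * 'I_k.+1)%type.
Notation weighted_blocks n k := (n.-bseq (weighted_block n k)).

Definition is_decorated_partition (n k : nat) (s : weighted_blocks n k) : bool :=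
  [&& all (fun b : weighted_block n k => b.1 != set0) s,
      pairwise (fun b b' : weighted_block n k => [disjoint b.1 & b'.1]) s,
      \bigcup_(b <- s) b.1 == [set: 'I_n],
      all (fun b : weighted_block n k => 0 < b.2) s &
      \sum_(b <- s) b.2 == k].

Definition rot_equiv (n k : nat) : rel (weighted_blocks n k) :=
  fun s s' => [exists j : 'I_n.+1, rot j s == s' :> seq _].

(* A decorated ordered set partition of type (k, n) is a rotation class of
   sequences (L_1, w_1), ..., (L_m, w_m). *)
Definition dosps (n k : nat) : {set {set weighted_blocks n k}} :=
  equivalence_partition (@rot_equiv n k)
    [set s | is_decorated_partition s].

Definition seq_compatible (n k : nat) (c : 'I_n -> nat)
    (s : weighted_blocks n k) : bool :=
  all (fun b : weighted_block n k => b.2 < \sum_(i in b.1) c i) s.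

(* Position on the circle of the block containing [i]. *)
Definition pos (n k : nat) (s : weighted_blocks n k) (i : 'I_n) : nat :=
  (\sum_(b <- take (find (fun b : weighted_block n k => i \in b.1) s) s) b.2) %% k.

(* [ordS i] is the cyclic successor of [i]; adding [k] avoids truncated
   subtraction. *)
Definition clockwise_dist (n k : nat) (s : weighted_blocks n k) (i : 'I_n) : nat :=
  (pos s (ordS i) + k - pos s i) %% k.

Definition seq_has_winding (n k : nat) (d : nat) (s : weighted_blocks n k) : bool :=
  \sum_(i < n) clockwise_dist s i == d * k.

(* Compatibility and winding number do not depend on the first block, so
   asking for them at every representative is the same as at one. *)
Definition compatible (n k : nat) (c : 'I_n -> nat)
    (X : {set weighted_blocks n k}) : bool :=
  [forall s in X, seq_compatible c s].

Definition has_winding (n k : nat) (d : nat)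
    (X : {set weighted_blocks n k}) : bool :=
  [forall s in X, seq_has_winding d s].

From mathcomp Require Import boolp classical_sets cardinality reals.

Import Order.TTheory GRing.Theory Num.Theory.

Local Open Scope classical_set_scope.
Local Open Scope ring_scope.

Definition dilate (R : realType) (n t : nat) (P : set 'rV[R]_n) :
  set 'rV[R]_n := [set t%:R *: x | x in P].

Definition lattice_points (R : realType) (n : nat) (P : set 'rV[R]_n) :
  set 'rV[int]_n := [set z | P (map_mx intr z)].

(* [fset_set A] is empty when [A] is infinite; for a polytope the set of
   lattice points of a dilate is finite. *)
Definition ehr (R : realType) (n : nat) (P : set 'rV[R]_n) (t : nat) : nat :=
  if t == 0%N then 1%N else #|` fset_set (lattice_points (dilate t P))|%fset.

(* [P] contains the [d + 1] affinely independent points [x] and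
   [x + row i A], [i < d]. *)
Definition contains_simplex (R : realType) (n : nat) (P : set 'rV[R]_n)
    (d : nat) : Prop :=
  exists (x : 'rV[R]_n) (A : 'M[R]_(d, n)),
    [/\ P x, forall i, P (x + row i A) & row_free A].

Definition polytope_dim (R : realType) (n : nat) (P : set 'rV[R]_n) : nat :=
  (\max_(d < n.+1 | `[< contains_simplex P d >]) d)%N.

(* The identity of formal power series
     (1 - x)^(dim P + 1) * sum_(j >= 0) ehr(P, j) x^j = h(x),
   stated modulo x^N for every N. *)
Definition is_hstar (R : realType) (n : nat) (P : set 'rV[R]_n)
    (h : {poly int}) : Prop :=
  forall N : nat,
    take_poly N ((1 - 'X) ^+ (polytope_dim P).+1 *
                 \poly_(j < N) (ehr P j)%:R) = take_poly N h.

(* At most one polynomial satisfies [is_hstar P]; it exists when [P] is a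
   lattice polytope, and [hstar P] is 0 if there is none. *)
Definition hstar (R : realType) (n : nat) (P : set 'rV[R]_n) : {poly int} :=
  xget 0 [set h | is_hstar P h].

Definition Rkc (R : realType) (n k : nat) (c : 'I_n -> nat) : set 'rV[R]_n :=
  [set x | (forall i, 0 <= x 0 i <= (c i)%:R) /\ \sum_i x 0 i = k%:R].

(* Main.v *)
Require Import Defs.
From HB Require Import structures.
From mathcomp Require Import all_boot all_order all_algebra finmap.
From mathcomp Require Import ring lra zify qpoly.

(** Write the lattice point count as
      [ehr t = [q^(t k)] prod_i (1 + q + ... + q^(t c_i))]
    and expand the product over the sets [S] of indices where the upper bound
    is violated.  Clearing the denominator [(1 - x)^n] gives
      [h*_d = sum_(S, c(S) < k) (-1)^|S| [q^(d r - |S|)] (1 + ... + q^(r-1))^n],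
    with [r = k - c(S)].  Reading the exponents as the steps of a closed walk
    on a circle of length [r], the [S]-term counts the maps [g : [n] -> Z/r]
    with [g 0 = 0] and [d] cyclic descents, an equality [g (j-1) = g j] being
    counted as a descent when [j] is in [S].

    Both this alternating sum and the number of compatible decorated ordered
    set partitions are traces in one algebra: functions on the subsets of [[n]]
    with the product
      [(f * g)(B) = sum_(T <= B) x^(crossings T (B \ T)) f(T) g(B \ T)]
    over [K = Z[x][z]/(z^(k+1))], where [crossings T U] is the number of [i] in
    [U] with [i+1] in [T].  There [D f = (f restricted to sets containing o)] is
    a derivation and [tr f = f([n])] is a trace.  With [Z(T) = z^c(T)],
    [I(T) = 1] and [M = Z - z I], the blocks have weight [1 - M / (1 - z)], so
    that partitions are counted by [- tr (D M * M^-1)], while the walks are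
    counted by [- tr (D W * W^-1)] with [W = 1 - z Z^-1 I = Z^-1 M].  The
    difference of the two is [tr (D (Z^-1) * Z)], a multiple of [z^c([n])],
    which is [0] because [k < c([n])]. *)

Set Implicit Arguments.
Unset Strict Implicit.
Unset Printing Implicit Defensive.

Import Order.TTheory GRing.Theory Num.Theory.
Local Open Scope ring_scope.

(** * The algebra of set functions *)

Section Crossings.
Variable n : nat.
Implicit Types A B T : {set 'I_n}.

Definition crossings T B : nat := (\sum_(i in B) (ordS i \in T))%N.

Lemma crossings_setUl T1 T2 B : [disjoint T1 & T2] ->
  crossings (T1 :|: T2) B = (crossings T1 B + crossings T2 B)%N.
Proof.
move=> dT; rewrite /crossings -big_split /=; apply: eq_bigr => i _.
rewrite inE; case: (boolP (ordS i \in T1)) => //= h1.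
by rewrite (disjointFr dT h1).
Qed.

Lemma crossings_setUr T B1 B2 : [disjoint B1 & B2] ->
  crossings T (B1 :|: B2) = (crossings T B1 + crossings T B2)%N.
Proof.
by move=> dB; rewrite /crossings -bigU //; apply: eq_bigl => i; rewrite !inE.
Qed.

Lemma crossings0l B : crossings set0 B = 0%N.
Proof. by rewrite /crossings big1 // => i _; rewrite inE. Qed.

Lemma crossings0r T : crossings T set0 = 0%N.
Proof. by rewrite /crossings big_set0. Qed.

(* Along the cycle, a set is entered as often as it is left. *)
Lemma crossings_setC T : crossings T (~: T) = crossings (~: T) T.
Proof.
apply/eqP; rewrite -(eqn_add2l (crossings T T)) -crossings_setUr; last first.
  by rewrite disjoints_subset setCK.
rewrite -crossings_setUl; last by rewrite disjoints_subset setCK.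
rewrite setUCr /crossings [X in _ == X](eq_bigr (fun=> 1%N)) => [|i _]; last first.
  by rewrite inE.
rewrite sum1_card (eq_bigl predT) => [|i]; last by rewrite inE.
rewrite -(reindex_inj (@ordS_inj n) (P := predT) (F := fun i => (i \in T) : nat)).
by rewrite -big_mkcond sum1_card.
Qed.

End Crossings.

Lemma subset_setU_setD (I : finType) (A T V : {set I}) :
  T \subset A ->
  ((T \subset T :|: V) && (T :|: V \subset A) && ((T :|: V) :\: T == V))
  = (V \subset A :\: T).
Proof.
move=> TA; rewrite subsetUl subUset TA subsetD /=; congr andb.
by rewrite setDUl setDv set0U; apply/eqP/setDidPl.
Qed.

(** The type records [x], so that the ring structure put on it below can depend on the weight of a
    crossing. *)
Definition setalg (K : comNzRingType) (n : nat) (x : K) := {ffun {set 'I_n} -> K}.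

HB.instance Definition _ (K : comNzRingType) n (x : K) :=
  GRing.Zmodule.on (@setalg K n x).

Section SetAlgebra.
Variables (K : comNzRingType) (n : nat) (x : K).
Local Notation A := (@setalg K n x).
Implicit Types (f g h : A) (B T U : {set 'I_n}).

Definition conv f g : A :=
  [ffun B : {set 'I_n} => \sum_(T : {set 'I_n} | T \subset B)
     x ^+ crossings T (B :\: T) * (f T * g (B :\: T))].

Definition scal (a : K) : A := [ffun B : {set 'I_n} => if B == set0 then a else 0].

Lemma convE f g B : conv f g B = \sum_(T : {set 'I_n} | T \subset B)
     x ^+ crossings T (B :\: T) * (f T * g (B :\: T)).
Proof. by rewrite ffunE. Qed.

Lemma convA : associative conv.
Proof.
move=> f g h; apply/ffunP => B; rewrite !convE.
(* Both sides are sums over chains T <= U <= B; the exponent counts the crossings from each of the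
   three parts into the earlier ones. *)
transitivity (\sum_(T : {set 'I_n} | T \subset B)
  \sum_(U : {set 'I_n} | (T \subset U) && (U \subset B))
   x ^+ (crossings T (U :\: T) + crossings U (B :\: U))
   * (f T * g (U :\: T) * h (B :\: U))).
  apply: eq_bigr => T TB; rewrite convE.
  rewrite [RHS](reindex_onto (fun V => T :|: V) (fun U => U :\: T)) /=; last first.
    by move=> U /andP[TU UB]; rewrite -{1}(setIidPr TU) setID.
  rewrite (eq_bigl _ _ (fun V => subset_setU_setD V TB)).
  rewrite !mulr_sumr; apply: eq_bigr => V VB.
  have dTV : [disjoint T & V].
    by move: VB; rewrite subsetD disjoint_sym => /andP[].
  have -> : (T :|: V) :\: T = V.
    by rewrite setDUl setDv set0U; apply/setDidPl; rewrite disjoint_sym.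
  have -> : B :\: T = V :|: (B :\: (T :|: V)).
    by rewrite -setDDl -{1}(setIidPr VB) setID.
  set W := B :\: (T :|: V).
  have dVW : [disjoint V & W].
    by rewrite disjoint_sym disjoints_subset; apply/subsetP => i; rewrite !inE => /andP[/norP[]].
  have -> : (V :|: W) :\: V = W.
    by rewrite setDUl setDv set0U; apply/setDidPl; rewrite disjoint_sym.
  by rewrite crossings_setUr // crossings_setUl // !exprD; ring.
rewrite (exchange_big_dep (fun U => U \subset B)) /=; last first.
  by move=> T U _ /andP[].
apply: eq_bigr => U UB; rewrite convE mulr_suml mulr_sumr.
rewrite (eq_bigl (fun T => T \subset U)); last first.
  by move=> T; rewrite UB andbT andb_idl // => TU; apply: subset_trans UB.
by apply: eq_bigr => T TU; rewrite addnC exprD !mulrA.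
Qed.

Lemma mul_scalE a f B : conv (scal a) f B = a * f B.
Proof.
rewrite convE (bigD1 set0) ?sub0set //= big1 => [|T /andP[_ /negPf T0]].
  by rewrite addr0 crossings0l expr0 mul1r ffunE eqxx setD0.
by rewrite ffunE T0 mul0r mulr0.
Qed.

Lemma mulr_scalE a f B : conv f (scal a) B = a * f B.
Proof.
rewrite convE (bigD1 B) ?subxx //= big1 => [|T /andP[TB nT]].
  by rewrite addr0 setDv crossings0r expr0 mul1r ffunE eqxx mulrC.
rewrite ffunE setD_eq0 ifN ?mulr0 //; apply: contra nT => BT.
by rewrite eqEsubset TB.
Qed.

Lemma conv1f : left_id (scal 1) conv.
Proof. by move=> f; apply/ffunP => B; rewrite mul_scalE mul1r. Qed.

Lemma convf1 : right_id (scal 1) conv.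
Proof. by move=> f; apply/ffunP => B; rewrite mulr_scalE mul1r. Qed.

Lemma convDl : left_distributive conv +%R.
Proof.
move=> f g h; apply/ffunP => B; rewrite [RHS]ffunE !convE -big_split.
by apply: eq_bigr => T _; rewrite ffunE mulrDl mulrDr.
Qed.

Lemma convDr : right_distributive conv +%R.
Proof.
move=> f g h; apply/ffunP => B; rewrite [RHS]ffunE !convE -big_split.
by apply: eq_bigr => T _; rewrite ffunE mulrDr mulrDr.
Qed.

HB.instance Definition _ :=
  GRing.Zmodule_isPzRing.Build A convA conv1f convf1 convDl convDr.

Lemma mulE f g B : (f * g) B = \sum_(T : {set 'I_n} | T \subset B)
     x ^+ crossings T (B :\: T) * (f T * g (B :\: T)).
Proof. exact: convE. Qed.

Lemma scalM a b : scal (a * b) = scal a * scal b.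
Proof.
apply/ffunP => B; rewrite mul_scalE !ffunE; case: ifP => // _.
by rewrite mulr0.
Qed.

Lemma scal1 : scal 1 = 1. Proof. by []. Qed.

Lemma scalX a m : scal (a ^+ m) = scal a ^+ m.
Proof. by elim: m => [|m IH]; rewrite ?expr0 // !exprS scalM IH. Qed.

Lemma scal0 : scal 0 = 0.
Proof. by apply/ffunP => B; rewrite !ffunE; case: ifP. Qed.

Lemma scalC a f : scal a * f = f * scal a.
Proof. by apply/ffunP => B; rewrite mul_scalE mulr_scalE. Qed.

Lemma sum_setalgE (I : Type) (r : seq I) (P : pred I) (F : I -> A) B :
  (\sum_(i <- r | P i) F i) B = \sum_(i <- r | P i) F i B.
Proof.
by rewrite (big_morph (fun f : A => f B) (id1 := 0) (op1 := +%R)) // => [f g|];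
   rewrite ffunE.
Qed.

(* A derivation, because a disjoint union contains [o] through exactly one of
   its parts. *)
Definition deriv_at (o : 'I_n) f : A :=
  [ffun B : {set 'I_n} => if o \in B then f B else 0].

Lemma deriv_atM o f g :
  deriv_at o (f * g) = deriv_at o f * g + f * deriv_at o g.
Proof.
apply/ffunP => B; rewrite [RHS]ffunE ffunE !mulE -big_split /=.
case: (boolP (o \in B)) => oB; last first.
  rewrite big1 // => T TB; rewrite !ffunE !inE (negPf oB) andbF.
  by rewrite ifN ?mul0r ?mulr0 ?addr0 //; apply: contra oB => /(subsetP TB).
apply: eq_bigr => T TB; rewrite !ffunE !inE oB andbT.
by case: (o \in T); rewrite /= ?mulr0 ?mul0r ?mulr0 ?addr0 ?add0r.
Qed.

Lemma deriv_atB o f g : deriv_at o (f - g) = deriv_at o f - deriv_at o g.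
Proof. by apply/ffunP => B; rewrite !ffunE; case: ifP; rewrite ?subr0. Qed.

Lemma deriv_at_scal o a : deriv_at o (scal a) = 0.
Proof.
by apply/ffunP => B; rewrite !ffunE; case: eqP => [->|_]; rewrite ?inE ?if_same.
Qed.

(** Exchanging [T] with its complement swaps the factors, and [crossings_setC] preserves the power
    of [x]. *)
Lemma trace_mulC f g : (f * g) [set: 'I_n] = (g * f) [set: 'I_n].
Proof.
rewrite !mulE (reindex_inj (@setC_inj _)) /=.
apply: eq_big => [T|T _]; first by rewrite !subsetT.
by rewrite !setTD setCK -crossings_setC; ring.
Qed.

(** Each of the [m] factors must receive a nonempty part of [B]. *)
Lemma expr_small_eq0 f m B : f set0 = 0 -> (#|B| < m)%N -> (f ^+ m) B = 0.
Proof.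
move=> f0; elim: m B => [//|m IH] B Bm; rewrite exprS mulE big1 // => T TB.
have [->|T0] := eqVneq T set0; first by rewrite f0 mul0r mulr0.
rewrite IH ?mulr0 //; rewrite -card_gt0 in T0; rewrite ltnS in Bm.
apply: leq_trans Bm; rewrite cardsD (setIidPr TB) ltn_subrL T0.
by rewrite (leq_trans T0) // subset_leq_card.
Qed.

Lemma geometric_inverse f : f set0 = 0 ->
  (1 - f) * (\sum_(m < n.+1) f ^+ m) = 1.
Proof.
move=> f0; rewrite -opprB mulNr -subrX1.
suff -> : f ^+ n.+1 = 0 by rewrite sub0r opprK.
apply/ffunP => B; rewrite expr_small_eq0 ?ffunE // ltnS.
by rewrite -[X in (_ <= X)%N]card_ord max_card.
Qed.

Definition multfun (h : 'I_n -> K) : A := [ffun T : {set 'I_n} => \prod_(i in T) h i].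

End SetAlgebra.

Lemma prod_add_in (K : comNzRingType) (I : finType) (B : {set I}) (a b : I -> K) :
  \prod_(j in B) (a j + b j) =
  \sum_(S : {set I} | S \subset B)
     (\prod_(j in S) a j) * \prod_(j in B :\: S) b j.
Proof.
rewrite big_mkcond (eq_bigr (fun j => (if j \in B then a j else 0)
   + (if j \in B then b j else 1))); last first.
  by move=> j _; case: ifP; rewrite ?add0r.
rewrite bigA_distr (bigID (fun S : {set I} => S \subset B)) /= addrC big1 ?add0r.
  rewrite [RHS]big_mkcond [LHS]big_mkcond; apply: eq_bigr => S _ /=.
  case: ifP => // SB; rewrite (bigID (mem S)) /=; congr (_ * _).
    by apply: eq_bigr => j jS; rewrite jS (subsetP SB).
  rewrite [LHS]big_mkcond [RHS]big_mkcond; apply: eq_bigr => j _; rewrite !inE.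
  by case: (j \in S); case: (j \in B).
move=> S /subsetPn[j jS jB]; rewrite (bigD1 j) //= jS (negPf jB).
by rewrite mul0r.
Qed.

Lemma crossings_pred n (S B : {set 'I_n}) :
  crossings S B = (\sum_(j in S) (ord_pred j \in B))%N.
Proof.
rewrite /crossings big_mkcond [RHS]big_mkcond [RHS](reindex_inj (@ordS_inj n)) /=.
by apply: eq_bigr => i _; rewrite ordSK; do 2!case: (_ \in _).
Qed.

(** Otherwise the complement of [B] would be nonempty and closed under successor, hence the whole
    cycle. *)
Lemma exists_ord_pred_notin n (B : {set 'I_n}) :
  B != set0 -> B != setT -> exists2 j, j \in B & ord_pred j \notin B.
Proof.
move=> B0 BT; apply/exists_inP; apply: contraR B0.
rewrite negb_exists_in => /forall_inP clB.
have [i0 i0B] : exists i, i \notin B.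
  by apply/existsP; apply: contraR BT; rewrite negb_exists => /forallP h;
     apply/eqP/setP => i; rewrite inE; have := h i; rewrite negbK.
have step i : i \notin B -> ordS i \notin B.
  by apply: contra => /clB; rewrite negbK ordSK.
case: n B i0 {BT} i0B clB step => [|n] B i0 i0B clB step; first by case: i0 {i0B}.
have up (i : 'I_n.+1) m : i \notin B -> inord ((i + m) %% n.+1) \notin B.
  move=> iB; elim: m => [|m IH].
    by rewrite addn0 modn_small // inord_val.
  suff -> : inord ((i + m.+1) %% n.+1) = ordS (inord ((i + m) %% n.+1)) :> 'I_n.+1.
    exact: step.
  apply: val_inj; rewrite /= !inordK ?ltn_pmod //.
  by rewrite -[in RHS]addn1 modnDml addn1 addnS.
apply/eqP/setP => j; rewrite inE; apply/negbTE.
(* This many steps lead from [i0] to [j], also when [j < i0]. *)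
have := up i0 (n.+1 - i0 + j)%N i0B.
by rewrite addnA subnKC ?modnDl ?modn_small ?inord_val // ltnW.
Qed.

(** * The trace identity *)

Section TraceIdentity.
Variables (K : comNzRingType) (x z : K) (n k : nat) (c : 'I_n -> nat) (o : 'I_n).
Local Notation A := (@setalg K n x).
Implicit Types (B S T : {set 'I_n}).

Definition csum T : nat := (\sum_(i in T) c i)%N.

Definition zfun : A := multfun x (fun i => z ^+ c i).
(** The inverse of [zfun] in closed form; see [zinvK] and [zfunK]. *)
Definition zinv : A :=
  [ffun S : {set 'I_n} => (-1) ^+ #|S| * z ^+ csum S * x ^+ crossings S S].
(** This is Z^-1 I, multiplied out; see [cluster_funE]. *)
Definition cluster_fun : A :=
  [ffun B : {set 'I_n} => \prod_(j in B) (1 - z ^+ c j * x ^+ (ord_pred j \in B))].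
Definition block_fun : A :=
  [ffun T : {set 'I_n} => \sum_(w < k.+1 | (0 < w < csum T)%N) z ^+ w].

Lemma csumU S T : [disjoint S & T] -> csum (S :|: T) = (csum S + csum T)%N.
Proof.
by move=> dB; rewrite /csum -bigU //; apply: eq_bigl => i; rewrite !inE.
Qed.

(* The alternating sum over [S] factors, because [crossings S S + crossings S (B \ S)]
   counts the [j] in [S] whose predecessor is in [B]. *)
Lemma zinv_multfun (h : 'I_n -> K) B :
  (zinv * multfun x h) B =
  \prod_(j in B) (h j - z ^+ c j * x ^+ (ord_pred j \in B)).
Proof.
rewrite (eq_bigr (fun j => - (z ^+ c j * x ^+ (ord_pred j \in B)) + h j));
  last by move=> j _; rewrite addrC.
rewrite prod_add_in mulE; apply: eq_bigr => S SB; rewrite !ffunE.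
rewrite prodrN big_split /= -!expr_sum -crossings_pred.
have -> : crossings S B = (crossings S S + crossings S (B :\: S))%N.
  rewrite -crossings_setUr; last by rewrite disjoint_sym disjoints_subset subsetDr.
  by rewrite -[in LHS](setID B S) (setIidPr SB).
by rewrite exprD; ring.
Qed.

Hypotheses (c_gt0 : forall i, (0 < c i)%N) (k_lt : (k < \sum_(i < n) c i)%N).
Hypothesis zk : z ^+ k.+1 = 0.

Lemma z_big m : (k < m)%N -> z ^+ m = 0.
Proof. by move=> km; rewrite -(subnKC km) exprD zk mul0r. Qed.

Lemma csum_setT : csum setT = (\sum_(i < n) c i)%N.
Proof. by apply: eq_bigl => i; rewrite inE. Qed.

Lemma zfunE T : zfun T = z ^+ csum T.
Proof. by rewrite ffunE expr_sum. Qed.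

(** At [B] the factors are z^(c j) (1 - x^[pred j in B]). If [B] is nonempty and proper, some
    predecessor lies outside and its factor is 0; at the full set z^c([n]) = 0 because k <
    c([n]). *)
Lemma zinvK : zinv * zfun = 1.
Proof.
apply/ffunP => B; rewrite zinv_multfun [RHS]ffunE.
have [->|B0] := eqVneq B set0; first by rewrite big_set0.
under eq_bigr do rewrite -{1}[z ^+ _]mulr1 -mulrBr.
rewrite big_split /= -expr_sum -/(csum B).
have [->|BT] := eqVneq B setT; first by rewrite z_big ?mul0r ?csum_setT.
have [j jB jB'] := exists_ord_pred_notin B0 BT.
by rewrite (bigD1 j jB) /= (negPf jB') expr0 subrr mul0r mulr0.
Qed.

(** Since [1 - zfun] is nilpotent, [zfun] has a right inverse, which must agree with the left
    inverse [zinv]. *)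
Lemma zfunK : zfun * zinv = 1.
Proof.
have H : (1 - zfun) set0 = 0 by rewrite !ffunE eqxx big_set0 subrr.
have := geometric_inverse H; rewrite opprB addrCA subrr addr0.
set R := \sum_(m < _) _ => zR; rewrite -[X in zfun * X]mulr1 -zR.
by rewrite [zinv * _]mulrA zinvK mul1r.
Qed.

Lemma cluster_funE : cluster_fun = zinv * multfun x (fun=> 1).
Proof. by apply/ffunP => B; rewrite zinv_multfun ffunE. Qed.

Lemma truncated_geometric (C N : nat) : (0 < C)%N ->
  (1 - z) * (\sum_(w < N.+1 | (0 < w < C)%N) z ^+ w) = z - z ^+ minn C N.+1.
Proof.
move=> C0; elim: N => [|N IH].
  rewrite big_mkcond big_ord1 /= mulr0 (minn_idPr _) // expr1.
  by rewrite subrr.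
rewrite big_mkcond big_ord_recr /= -big_mkcond mulrDr IH.
case: (ltnP N.+1 C) => NC.
  by rewrite (minn_idPr _) // !exprS; ring.
by rewrite mulr0 addr0 (minn_idPl _) // leqW.
Qed.

Lemma csum_gt0 T : T != set0 -> (0 < csum T)%N.
Proof.
case/set0Pn => j jT; rewrite /csum (bigD1 j) //=.
by rewrite (leq_trans (c_gt0 j)) // leq_addr.
Qed.

Lemma block_fun0 : block_fun set0 = 0.
Proof.
by rewrite ffunE /csum big_set0 big_pred0 // => w; rewrite ltn0 andbF.
Qed.

(** On a nonempty set the truncated geometric sum ends in z^min(c(T), k+1); the minimum can be
    replaced by c(T), as both powers vanish when c(T) > k. *)
Lemma block_fun_geometric :
  scal n x (1 - z) * (1 - block_fun) = zfun - scal n x z * multfun x (fun=> 1).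
Proof.
apply/ffunP => B; rewrite mul_scalE.
rewrite [in RHS]ffunE [X in _ = _ + X]ffunE mul_scalE zfunE.
rewrite [X in _ * X]ffunE [X in _ * (_ + X)]ffunE [X in _ * (X + _)]ffunE.
rewrite [in RHS]ffunE big1 // mulr1.
have [->|B0] := eqVneq B set0.
  by rewrite block_fun0 subr0 mulr1 /csum big_set0 expr0.
rewrite sub0r mulrN [block_fun B]ffunE truncated_geometric ?csum_gt0 // opprB.
congr (_ - _); case: (leqP (csum B) k.+1) => // h.
by rewrite zk z_big // ltnW.
Qed.

(** The sums over [m] and [r] are geometric inverses, so the two sides are the logarithmic
    derivatives - tr (D M * M^-1) and - tr (D W * W^-1). *)
Lemma trace_identity :
  (deriv_at o block_fun * (\sum_(m < n.+1) block_fun ^+ m)) setT =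
  (scal n x z * deriv_at o cluster_fun *
     (\sum_(r < k.+1) (scal n x z * cluster_fun) ^+ r)) setT.
Proof.
set P := \sum_(m < n.+1) block_fun ^+ m; set Q := \sum_(r < k.+1) (scal n x z * _) ^+ _.
set D := deriv_at o; set V := cluster_fun; set sz := scal n x z.
pose M := zfun - sz * multfun x (fun=> 1).
pose u := \sum_(j < k.+1) z ^+ j.
have uz : (1 - z) * u = 1.
  by rewrite -opprB mulNr -subrX1 zk sub0r opprK.
have suz : scal n x (1 - z) * scal n x u = 1 by rewrite -scalM uz.
have bP : (1 - block_fun) * P = 1 by apply: geometric_inverse; exact: block_fun0.
have bM : scal n x (1 - z) * (1 - block_fun) = M by exact: block_fun_geometric.
pose Mi := scal n x u * P.
have MMi : M * Mi = 1.
  by rewrite /Mi -bM mulrA -[X in X * _]mulrA -[_ * scal n x u]scalC !mulrA suz mul1r.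
have DM : D M = - (scal n x (1 - z) * D block_fun).
  rewrite -bM /D deriv_atM deriv_at_scal mul0r add0r deriv_atB.
  by rewrite -(scal1 n x) deriv_at_scal sub0r mulrN.
have lhs : D block_fun * P = - (D M * Mi).
  rewrite DM mulNr opprK /Mi [in RHS]scalC -!mulrA; congr (_ * _).
  by rewrite mulrA suz mul1r.
have WE : 1 - sz * V = zinv * M.
  rewrite /M mulrBr zinvK [V]cluster_funE; congr (_ - _).
  by rewrite mulrA [sz * zinv]scalC mulrA.
(* The geometric series stops because the power [k.+1] of [sz * V] carries z^(k+1) = 0. *)
have QW : Q * (1 - sz * V) = 1.
  have comm : GRing.comm Q (1 - sz * V).
    apply: commrB; first exact: commr1.
    apply: commr_sym; apply: commr_sum => r _; exact: commrX.
  rewrite comm -opprB mulNr -subrX1 exprMn_comm; last exact: scalC.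
  by rewrite -[sz ^+ _]scalX zk scal0 mul0r sub0r opprK.
(* M^-1 Z is a right inverse of W = Z^-1 M, hence equal to the left inverse [Q]. *)
have QE : Q = Mi * zfun.
  have H : (1 - sz * V) * (Mi * zfun) = 1.
    by rewrite WE -(mulrA zinv M) (mulrA M Mi) MMi mul1r zinvK.
  by rewrite -[LHS]mulr1 -H mulrA QW mul1r.
have DW : sz * D V = - (D zinv * M + zinv * D M).
  rewrite -[X in - X]deriv_atM -WE /D deriv_atB -(scal1 n x) deriv_at_scal sub0r opprK.
  by rewrite deriv_atM deriv_at_scal mul0r add0r.
rewrite lhs DW QE mulNr mulrDl opprD.
have -> : D zinv * M * (Mi * zfun) = D zinv * zfun.
  by rewrite -(mulrA _ M) (mulrA M Mi) MMi mul1r.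
rewrite [RHS]ffunE !(fun f : A => ffunE (fun B => - f B)) /=.
(* Cyclicity of the trace brings [zfun] next to [zinv]. *)
have -> : (zinv * D M * (Mi * zfun)) setT = (D M * Mi) setT.
  by rewrite -(mulrA zinv) trace_mulC -(mulrA (D M)) -(mulrA Mi) zfunK mulr1.
suff -> : (D zinv * zfun) setT = 0 by rewrite oppr0 add0r.
rewrite mulE big1 // => T _; rewrite ffunE zfunE [zinv T]ffunE.
case: ifP => _; rewrite ?mul0r ?mulr0 //.
(* The two exponents add up to c([n]) > k. *)
have zT : z ^+ csum T * z ^+ csum (setT :\: T) = 0.
  rewrite -exprD -csumU setTD ?setUCr ?z_big ?csum_setT //.
  by rewrite disjoints_subset setCK.
by rewrite [X in _ * X]mulrAC -(mulrA _ (z ^+ csum T)) zT mulr0 mul0r mulr0.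
Qed.

End TraceIdentity.

(** * Expansions over ordered set partitions *)

Section OrderedPartitions.
Variable n : nat.
Implicit Types (B T : {set 'I_n}) (t : seq {set 'I_n}).

(** The recursion follows the unfolding of an iterated product. Blocks may be empty, as the fibers
    of a map may be. *)
Fixpoint opart B t : bool :=
  if t is T :: t' then (T \subset B) && opart (B :\: T) t' else B == set0.

(** The exponent of [x] that [t] receives in an iterated product. *)
Fixpoint ostat t : nat :=
  if t is T :: t' then (crossings T (\bigcup_(U <- t') U) + ostat t')%N else 0%N.

Definition block_index t (i : 'I_n) : nat := find (fun T : {set 'I_n} => i \in T) t.

Lemma disjoint_bigcup_seq T t :
  [disjoint T & \bigcup_(U <- t) U] = all (fun U : {set 'I_n} => [disjoint T & U]) t.
Proof.
elim: t => [|U t IH]; first by rewrite big_nil disjoint_sym disjoints_subset sub0set.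
rewrite big_cons /= -IH disjoint_sym ![[disjoint T & _]]disjoint_sym.
by rewrite !disjoints_subset subUset.
Qed.

Lemma opartE B t :
  opart B t = pairwise (fun T U : {set 'I_n} => [disjoint T & U]) t
              && (\bigcup_(T <- t) T == B).
Proof.
elim: t B => [|T t IH] B /=; first by rewrite big_nil eq_sym.
rewrite IH big_cons -disjoint_bigcup_seq andbCA [RHS]andbAC.
rewrite [RHS]andbC; congr andb; set U := \bigcup_(_ <- _) _.
apply/andP/andP => [[TB /eqP ->]|[dTU /eqP <-]].
  rewrite disjoint_sym disjoints_subset subsetDr; split=> //.
  by rewrite -{1}(setIidPr TB) setID.
rewrite subsetUl; split=> //; rewrite setDUl setDv set0U eq_sym.
by apply/eqP/setDidPl; rewrite disjoint_sym.
Qed.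

Lemma opart_bigcup B t : opart B t -> \bigcup_(T <- t) T = B.
Proof. by rewrite opartE => /andP[_ /eqP]. Qed.

Lemma block_index_lt B t i : opart B t -> (block_index t i < size t)%N = (i \in B).
Proof.
move=> /opart_bigcup <-; rewrite -has_find; elim: t => [|T t IH] /=.
  by rewrite big_nil inE.
by rewrite big_cons inE IH.
Qed.

Lemma mem_block B t i j : opart B t -> (j < size t)%N ->
  (i \in nth set0 t j) = (block_index t i == j).
Proof.
elim: t B j => [//|T t IH] B j /= /andP[TB tB] jt; rewrite /block_index /=.
case: j jt => [_|j jt] /=; first by case: (i \in T).
rewrite (IH _ _ tB) //; case: ifP => // iT; apply/negbTE.
rewrite eq_sym neq_ltn; apply/orP; left.
suff -> : block_index t i = size t by [].
apply/eqP; rewrite eqn_leq find_size leqNgt (block_index_lt _ tB).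
by rewrite !inE iT.
Qed.

(** Each crossing is recorded once, at the block of the successor, against the union of all later
    blocks. *)
Lemma ostat_index B t : opart B t ->
  ostat t = (\sum_(i | (i \in B) && (ordS i \in B))
               (block_index t (ordS i) < block_index t i))%N.
Proof.
elim: t B => [|T t IH] B /= => [/eqP ->|/andP[TB tB]].
  by rewrite big_pred0 // => i; rewrite inE.
rewrite (opart_bigcup tB) (IH _ tB) /crossings.
rewrite [X in (X + _)%N]big_mkcond [X in (_ + X)%N]big_mkcond -big_split /=.
rewrite [RHS]big_mkcond; apply: eq_bigr => i _; rewrite !inE /block_index /=.
have := subsetP TB i; have := subsetP TB (ordS i).
case: (ordS i \in T) => [/(_ isT) ->|_]; case: (i \in T) => [/(_ isT) ->|_] //=.
- by case: (i \in B).
- by rewrite if_same.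
- by rewrite if_same.
Qed.

Lemma ostat_setT t : opart setT t ->
  ostat t = (\sum_i (block_index t (ordS i) < block_index t i))%N.
Proof. by move/ostat_index ->; apply: eq_bigl => i; rewrite !inE. Qed.

End OrderedPartitions.

Lemma big_tuple_cons (K : nmodType) (X : finType) m (P : pred (seq X)) (G : seq X -> K) :
  \sum_(t : m.+1.-tuple X | P t) G t =
  \sum_b \sum_(t : m.-tuple X | P (b :: t)) G (b :: t).
Proof.
rewrite pair_big_dep /=.
rewrite (reindex (fun p : X * m.-tuple X => cons_tuple p.1 p.2)) //=.
exists (fun t => (thead t, behead_tuple t)) => [[b t] _|t _] /=.
  by congr pair; apply: val_inj.
by rewrite [in RHS](tuple_eta t); apply: val_inj.
Qed.

Section Expansion.
Variables (K : comNzRingType) (n : nat) (x : K) (X : finType).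
Variables (pi : X -> {set 'I_n}) (om : X -> K).
Implicit Types (q : pred X) (B : {set 'I_n}).

(** Used with [pi] the identity on sets for the walks and with [pi = fst] for the partitions; [q]
    serves to require [o] in the first block, which is the effect of the derivation. *)
Definition block_sum q : @setalg K n x :=
  [ffun T : {set 'I_n} => \sum_(b | (pi b == T) && q b) om b].

Definition ohead_sat q (s : seq X) : bool := if s is b :: _ then q b else true.

Definition opart_weight (s : seq X) : K :=
  x ^+ ostat (map pi s) * \prod_(b <- s) om b.

Lemma mul_block_sum q m (f : @setalg K n x) B :
  (forall B, f B = \sum_(t : m.-tuple X | opart B (map pi t)) opart_weight t) ->
  (block_sum q * f) B =
  \sum_(t : m.+1.-tuple X | opart B (map pi t) && ohead_sat q t) opart_weight t.
Proof.
move=> fE; rewrite mulE.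
rewrite (big_tuple_cons _ (fun s => opart B (map pi s) && ohead_sat q s)) /=.
under eq_bigr => T TB do rewrite ffunE mulr_suml mulr_sumr.
transitivity (\sum_(b | (pi b \subset B) && q b)
   x ^+ crossings (pi b) (B :\: pi b) * (om b * f (B :\: pi b))).
  rewrite [RHS](partition_big pi (fun T => T \subset B)) => [|b /andP[] //].
  apply: eq_bigr => T TB; apply: eq_big => [b|b /andP[/eqP -> //]].
  by case: eqP => [->|]; rewrite ?TB ?andbT ?andbF.
rewrite [LHS]big_mkcond; apply: eq_bigr => b _.
case: ifP => [/andP[bB qb]|bB].
  rewrite fE !mulr_sumr; apply: eq_big => [t|t tB]; first by rewrite bB qb andbT.
  rewrite /opart_weight /= (opart_bigcup tB) big_cons exprD; ring.
by rewrite big_pred0 // => t; rewrite andbAC bB.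
Qed.

Lemma expr_block_sum m B :
  (block_sum predT ^+ m) B =
  \sum_(t : m.-tuple X | opart B (map pi t)) opart_weight t.
Proof.
elim: m B => [|m IH] B.
  rewrite big_mkcond (bigD1 [tuple]) //= big1 => [|t]; last by rewrite tuple0.
  by rewrite addr0 ffunE /opart_weight /= big_nil expr0 mulr1.
rewrite exprS (mul_block_sum _ _ IH); apply: eq_bigl => t.
by case: (tval t) => //= *; rewrite andbT.
Qed.

Lemma mul_expr_block_sum q m B :
  (block_sum q * block_sum predT ^+ m) B =
  \sum_(t : m.+1.-tuple X | opart B (map pi t) && ohead_sat q t) opart_weight t.
Proof. by apply: mul_block_sum => B'; apply: expr_block_sum. Qed.

End Expansion.

Section Fibers.
Variables (n r : nat).

Definition fibers (g : {ffun 'I_n -> 'I_r.+1}) : r.+1.-tuple {set 'I_n} :=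
  [tuple [set i | g i == j] | j < r.+1].

Lemma nth_fibers g (j : 'I_r.+1) : nth set0 (fibers g) j = [set i | g i == j].
Proof. by rewrite -tnth_nth tnth_mktuple. Qed.

Lemma opart_fibers g : opart setT (fibers g).
Proof.
rewrite opartE; apply/andP; split.
  apply/(pairwiseP set0) => a b; rewrite !inE !size_tuple => ar br ab.
  rewrite (nth_fibers g (Ordinal ar)) (nth_fibers g (Ordinal br)).
  rewrite disjoints_subset; apply/subsetP => i; rewrite !inE => /eqP ->.
  by rewrite -val_eqE /= neq_ltn ab.
apply/eqP/setP => i; rewrite big_tuple inE.
apply/bigcupP; exists (g i) => //.
by rewrite tnth_mktuple inE.
Qed.

Lemma block_index_fibers g i : block_index (fibers g) i = g i.
Proof.
apply/eqP; rewrite -(mem_block _ (opart_fibers g)) ?size_tuple //.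
by rewrite nth_fibers inE.
Qed.

(** A sequence of [r.+1] possibly empty blocks is the sequence of fibers of a unique map, and [o] is
    in the first block when the map sends it to 0. *)
Lemma sum_opart_fibers (K : nmodType) (o : 'I_n) (G : r.+1.-tuple {set 'I_n} -> K) :
  \sum_(t : r.+1.-tuple {set 'I_n} |
      opart setT (map id t) && ohead_sat (fun T : {set 'I_n} => o \in T) t) G t =
  \sum_(g : {ffun 'I_n -> 'I_r.+1} | g o == ord0) G (fibers g).
Proof.
rewrite (reindex_onto fibers (fun t => [ffun i => inord (block_index t i)])) /=.
  apply: eq_bigl => g; rewrite map_id opart_fibers /=.
  have -> : [ffun i => inord (block_index (fibers g) i)] == g.
    apply/eqP/ffunP => i; rewrite ffunE block_index_fibers.
    by apply: val_inj; rewrite /= inordK.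
  by rewrite andbT enum_ordSl /= inE.
move=> t; rewrite map_id => /andP[tP _].
apply: (@eq_from_tnth) => j; rewrite tnth_mktuple (tnth_nth set0).
apply/setP => i; rewrite inE ffunE (mem_block _ tP) ?size_tuple //.
rewrite -val_eqE /= inordK //.
by have := block_index_lt i tP; rewrite size_tuple inE => ->.
Qed.

End Fibers.

(* An equality counts as a descent at the indices in [S]. *)
Definition cyc_descents n r (S : {set 'I_n}) (g : 'I_n -> 'I_r) : nat :=
  (\sum_j ((g j < g (ord_pred j)) + ((j \in S) && (g (ord_pred j) == g j))))%N.

Section ClusterSide.
Variables (K : comNzRingType) (x z : K) (n : nat) (c : 'I_n -> nat) (o : 'I_n).
Local Notation V := (cluster_fun x z c).

Lemma block_sum_id (f : @setalg K n x) : block_sum x id f predT = f.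
Proof.
apply/ffunP => T; rewrite ffunE (eq_bigl (pred1 T)) ?big_pred1_eq // => U.
by rewrite andbT.
Qed.

Lemma block_sum_deriv (f : @setalg K n x) :
  block_sum x id f (fun T : {set 'I_n} => o \in T) = deriv_at o f.
Proof.
apply/ffunP => T; rewrite !ffunE big_mkcondr.
by rewrite (eq_bigl (pred1 T)) ?big_pred1_eq.
Qed.

Lemma cluster_expansion r :
  (deriv_at o V * V ^+ r) setT =
  \sum_(g : {ffun 'I_n -> 'I_r.+1} | g o == ord0) \sum_(S : {set 'I_n})
     (-1) ^+ #|S| * z ^+ csum c S * x ^+ cyc_descents S g.
Proof.
rewrite -block_sum_deriv -{2}(block_sum_id V) mul_expr_block_sum.
rewrite (sum_opart_fibers o (fun t => opart_weight x id V t)).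
apply: eq_bigr => g _; rewrite /opart_weight map_id (ostat_setT (opart_fibers g)).
under eq_bigr do rewrite !block_index_fibers.
rewrite (reindex_inj (@ord_pred_inj n)) /=.
under eq_bigr do rewrite ord_predK.
rewrite big_map big_enum /=.
(* The predecessor of [j] is in the block of [j] iff [g] agrees on the two, so the product over
   blocks becomes one over [j], which is then expanded over [S]. *)
transitivity (x ^+ (\sum_j (g j < g (ord_pred j)))%N *
  \prod_(j in setT) (- (z ^+ c j * x ^+ (g (ord_pred j) == g j)) + 1)).
  congr (_ * _); rewrite [RHS](partition_big g predT) //=.
  apply: eq_bigr => l _; rewrite ffunE.
  apply: eq_big => [j|j]; rewrite !inE //= => /eqP <-.
  by rewrite addrC.
rewrite prod_add_in mulr_sumr; apply: eq_big => [S|S _]; first by rewrite subsetT.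
rewrite prodrN big1_eq mulr1 big_split /= -!expr_sum -/(csum c S).
rewrite /cyc_descents big_split exprD /=.
have -> : (\sum_j ((j \in S) && (g (ord_pred j) == g j)) =
           \sum_(j in S) (g (ord_pred j) == g j))%N.
  by rewrite [RHS]big_mkcond; apply: eq_bigr => j _; case: (j \in S).
ring.
Qed.

End ClusterSide.

Section BlockSide.
Variables (K : comNzRingType) (x z : K) (n k : nat) (c : 'I_n -> nat) (o : 'I_n).
Local Notation X := (weighted_block n k).

(** Forbidden weights get the value 0, so that sums may run over all weighted blocks. *)
Definition block_weight (b : X) : K :=
  if (0 < b.2 < csum c b.1)%N then z ^+ b.2 else 0.

Lemma block_sum_fst q :
  block_sum x fst block_weight (fun b : X => q b.1) =
  [ffun T : {set 'I_n} => if q T then block_fun x z k c T else 0] :> setalg n x.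
Proof.
apply/ffunP => T; rewrite !ffunE.
rewrite (reindex_onto (fun w : 'I_k.+1 => (T, w)) snd) /=; last first.
  by move=> [U w] /andP[/eqP <-].
rewrite (eq_bigl (fun=> q T)); last by move=> w; rewrite !eqxx andbT.
case: (q T); last by rewrite big_pred0.
by rewrite [RHS]big_mkcond; apply: eq_bigr.
Qed.

Lemma block_expansion m :
  (deriv_at o (block_fun x z k c) * block_fun x z k c ^+ m) setT =
  \sum_(s : m.+1.-tuple X | [&& opart setT (map fst s),
      ohead_sat (fun b : X => o \in b.1) s &
      all (fun b : X => (0 < b.2 < csum c b.1)%N) s])
     x ^+ ostat (map fst s) * z ^+ (\sum_(b <- s) b.2)%N.
Proof.
rewrite -[deriv_at _ _](block_sum_fst (fun T : {set 'I_n} => o \in T)).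
have -> : block_fun x z k c = block_sum x fst block_weight predT.
  by rewrite (block_sum_fst predT); apply/ffunP => T; rewrite [RHS]ffunE.
rewrite mul_expr_block_sum; under [RHS]eq_bigl do rewrite andbA.
rewrite [RHS]big_mkcondr; apply: eq_bigr => s _; rewrite /opart_weight.
case: ifP => [sP|/negbT/allPn[b bs bP]].
  congr (_ * _); rewrite expr_sum big_seq [RHS]big_seq; apply: eq_bigr => b bs.
  by rewrite /block_weight (allP sP).
rewrite (big_rem b) //= /block_weight (negPf bP) mul0r mulr0 //.
Qed.

End BlockSide.

(** * Coefficients of the trace identity *)

Lemma in_qpolyXn_coef (A : comNzRingType) N (p q : {poly A}) m :
  in_qpoly 'X^(N.+1) p = in_qpoly 'X^(N.+1) q -> (m < N.+1)%N -> p`_m = q`_m.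
Proof.
move=> /(congr1 val) /=; rewrite mk_monic_Xn -!Pdiv.RingMonic.take_poly_rmodp => e mN.
by have := congr1 (fun p : {poly A} => p`_m) e; rewrite !coef_take_poly mN.
Qed.

Lemma in_qpolyXn (A : comNzRingType) N : in_qpoly ('X^(N.+1) : {poly A}) 'X^(N.+1) = 0.
Proof.
apply: val_inj => /=; rewrite mk_monic_Xn -Pdiv.RingMonic.take_poly_rmodp.
by rewrite -[X in take_poly _ X]mul1r take_polyMXn_0.
Qed.

Lemma coef_monomial2 (a b k d : nat) :
  (('X%:P : {poly {poly int}}) ^+ a * 'X^b)`_k`_d = ((b == k) && (a == d))%:R.
Proof.
rewrite -rmorphXn coefCM coefXn eq_sym; case: (b == k) => /=.
  by rewrite mulr1 coefXn eq_sym.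
by rewrite mulr0 coef0.
Qed.

Lemma coef_sign (m k d : nat) (p : {poly {poly int}}) :
  ((-1) ^+ m * p)`_k`_d = (-1) ^+ m * p`_k`_d.
Proof.
rewrite -![_ ^+ m]signr_odd; case: (odd m); rewrite ?expr0 ?mul1r //.
by rewrite !expr1 !mulN1r !coefN.
Qed.

Lemma sum_indicator_card (R : pzSemiRingType) (I : finType) (P Q : pred I) :
  \sum_(i | P i) (Q i)%:R = #|[set i | P i && Q i]|%:R :> R.
Proof.
rewrite -sum1_card natr_sum [LHS]big_mkcond [RHS]big_mkcond /=.
by apply: eq_bigr => i _; rewrite inE; case: (P i) => //; case: (Q i).
Qed.

Section CoefficientExtraction.
Variables (n k : nat) (c : 'I_n -> nat) (o : 'I_n).
Hypotheses (c_gt0 : forall i, (0 < c i)%N) (k_lt : (k < \sum_(i < n) c i)%N).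
Local Notation X := (weighted_block n k).

Definition rooted_compatible (s : seq X) : bool :=
  [&& opart setT (map fst s), ohead_sat (fun b : X => o \in b.1) s &
      all (fun b : X => (0 < b.2 < csum c b.1)%N) s].

(** This is the coefficient of z^k x^d in [trace_identity], taken over Z[x][z]/(z^(k+1)). *)
Lemma rooted_compatible_count d :
  \sum_(m < n.+1) #|[set s : m.+1.-tuple X | rooted_compatible s &&
      ((\sum_(b <- s) b.2 == k)%N && (ostat (map fst s) == d))]|%:R
  = \sum_(S : {set 'I_n} | (csum c S < k)%N) (-1) ^+ #|S| *
    #|[set g : {ffun 'I_n -> 'I_(k - csum c S).-1.+1} |
        (g o == ord0) && (cyc_descents S g == d)]|%:R :> int.
Proof.
pose phi : {rmorphism {poly {poly int}} ->
    {poly %/ ('X^(k.+1) : {poly {poly int}})}} := in_qpoly ('X^(k.+1)).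
pose x := phi 'X%:P; pose z := phi 'X.
have zk : z ^+ k.+1 = 0 by rewrite -rmorphXn; exact: in_qpolyXn.
have := trace_identity x o c_gt0 k_lt zk.
rewrite mulr_sumr sum_setalgE.
under eq_bigr do rewrite block_expansion.
rewrite mulr_sumr sum_setalgE.
(* The scalars are central; collecting them gives z^(r+1) tr (D V * V^r). *)
rewrite [in RHS](eq_bigr (fun r : 'I_k.+1 => z ^+ r.+1 *
   (deriv_at o (cluster_fun x z c) * cluster_fun x z c ^+ r) setT)); last first.
  move=> r _; rewrite exprMn_comm; last exact: scalC.
  rewrite -scalX -mulrA [_ * (scal _ _ _ * _)]mulrA -[_ * scal _ _ _]scalC.
  rewrite !mulrA -scalM -exprS -mulrA; exact: mul_scalE.
under [in RHS]eq_bigr do rewrite cluster_expansion.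
move=> E.
(* Both sides are lifted to Z[x][z], where coefficients can be read; congruence modulo z^(k+1) still
   determines that of z^k. *)
pose pL : {poly {poly int}} := \sum_(m < n.+1)
  \sum_(s : m.+1.-tuple X | rooted_compatible s)
     'X%:P ^+ ostat (map fst s) * 'X^(\sum_(b <- s) b.2)%N.
pose pR : {poly {poly int}} := \sum_(r < k.+1) 'X^(r.+1) *
  \sum_(g : {ffun 'I_n -> 'I_r.+1} | g o == ord0) \sum_(S : {set 'I_n})
     (-1) ^+ #|S| * 'X^(csum c S) * 'X%:P ^+ cyc_descents S g.
have : phi pL = phi pR.
  transitivity (\sum_(m < n.+1)
     \sum_(s : m.+1.-tuple X | rooted_compatible s)
       x ^+ ostat (map fst s) * z ^+ (\sum_(b <- s) b.2)%N).
    rewrite (rmorph_sum phi); apply: eq_bigr => m _; rewrite (rmorph_sum phi).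
    by apply: eq_bigr => s _; rewrite rmorphM !rmorphXn.
  rewrite E (rmorph_sum phi); apply: eq_bigr => r _; rewrite rmorphM rmorphXn; congr (_ * _).
  rewrite (rmorph_sum phi); apply: eq_bigr => g _; rewrite (rmorph_sum phi).
  by apply: eq_bigr => S _; rewrite !rmorphM !rmorphXn rmorphN1.
move/in_qpolyXn_coef => /(_ k (ltnSn k)) /(congr1 (fun p : {poly int} => p`_d)).
rewrite !coef_sum.
under eq_bigr => m _.
  rewrite !coef_sum; under eq_bigr do rewrite coef_monomial2.
  rewrite sum_indicator_card; over.
move=> ->.
transitivity (\sum_(r < k.+1) \sum_(S : {set 'I_n})
  \sum_(g : {ffun 'I_n -> 'I_r.+1} | g o == ord0)
    (-1) ^+ #|S| * ((r.+1 + csum c S == k)%N && (cyc_descents S g == d))%:R : int).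
  apply: eq_bigr => r _; rewrite exchange_big /= mulr_sumr !coef_sum.
  apply: eq_bigr => S _; rewrite mulr_sumr !coef_sum; apply: eq_bigr => g _.
  rewrite (_ : 'X^(r.+1) * _ = (-1) ^+ #|S| *
    ('X%:P ^+ cyc_descents S g * 'X^(r.+1 + csum c S))); last by rewrite exprD; ring.
  by rewrite coef_sign coef_monomial2.
rewrite exchange_big /= [RHS]big_mkcond; apply: eq_bigr => S _.
case: ltnP => Sk; last first.
  by rewrite big1 // => r _; rewrite big1 // => g _; rewrite gtn_eqF ?mulr0 //; lia.
(* For a given [S], only the circle of length r + 1 = k - c(S) contributes to z^k. *)
have rk : ((k - csum c S).-1 < k.+1)%N by lia.
rewrite (bigD1 (Ordinal rk)) //= [X in _ + X]big1 => [|r rP].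
  rewrite addr0 -sum_indicator_card mulr_sumr; apply: eq_bigr => g _.
  by have -> : ((k - csum c S).-1.+1 + csum c S == k)%N by lia.
rewrite big1 // => g _; rewrite (_ : (_ == k) = false) ?mulr0 //.
by apply: contraNF rP => /eqP h; apply/eqP/val_inj => /=; lia.
Qed.

End CoefficientExtraction.

(** * Closed walks on a circle and their steps *)

Lemma inZpD r a b : inZp (a + b) = inZp a + inZp b :> 'I_r.+1.
Proof. by apply: val_inj; rewrite /= modnDm. Qed.

Lemma inZp_sum r (I : Type) (s : seq I) (P : pred I) (F : I -> nat) :
  inZp (\sum_(i <- s | P i) F i)%N = \sum_(i <- s | P i) inZp (F i) :> 'I_r.+1.
Proof.
by rewrite (big_morph _ (@inZpD r) (id1 := 0)) //; apply: val_inj; rewrite /= mod0n.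
Qed.

(** The left side is at most 2r + 1 and congruent to [a] modulo r + 1; the carry is 1 exactly when a
    < b, or when a = b and [e] holds. *)
Lemma Zp_step_lift r (a b : 'I_r.+1) (e : bool) :
  ((a - b - inZp e : 'I_r.+1)%R + e + b =
   a + ((a < b) + (e && (b == a))) * r.+1)%N.
Proof.
set v := a - b - inZp e.
have hv : inZp (v + e + b)%N = a by rewrite !inZpD !valZpK /v subrK subrK.
clearbody v; have va := ltn_ord v; have vb := ltn_ord b; have vaa := ltn_ord a.
have := divn_eq (v + e + b) r.+1; move/(congr1 val): hv => /= ->.
have : ((v + e + b) %/ r.+1 < 2)%N by rewrite ltn_divLR //; case: (e) => /=; lia.
rewrite -[b == a]val_eqE /=.
by case: (_ %/ _)%N => [_|[_|//]]; case: e => /=; lia.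
Qed.

Section CyclicWalks.
Variables (n r : nat) (S : {set 'I_n.+1}).
Local Notation walk := {ffun 'I_n.+1 -> 'I_r.+1}.

(** The step into [j] has length 0..r outside [S] and 1..r+1 on [S]; subtracting the indicator gives
    both the same range. *)
Definition walk_steps (g : walk) : walk :=
  [ffun j => g j - g (ord_pred j) - inZp (j \in S)].

Definition walk_of_steps (l : walk) : walk :=
  [ffun i : 'I_n.+1 => \sum_(j < n.+1 | (0 < j <= i)%N) (l j + inZp (j \in S))].

(** Summing [Zp_step_lift] around the cycle, the positions cancel and each descent leaves r + 1. *)
Lemma sum_walk_steps (g : walk) :
  (\sum_j walk_steps g j + #|S| = cyc_descents S g * r.+1)%N.
Proof.
apply/eqP; rewrite -(eqn_add2r (\sum_j (g (ord_pred j) : nat))) -sum1_card.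
rewrite [X in (_ + X + _)%N]big_mkcond /=.
rewrite -!big_split /= (eq_bigr (fun j : 'I_n.+1 => g j + ((g j < g (ord_pred j)) +
   ((j \in S) && (g (ord_pred j) == g j))) * r.+1)%N); last first.
  by move=> j _; rewrite ffunE -Zp_step_lift; case: (j \in S).
rewrite big_split /= -big_distrl /= addnC; apply/eqP; congr addn.
by rewrite (reindex_inj (@ord_pred_inj n.+1)).
Qed.

Lemma ord_pred_val (j : 'I_n.+1) : (0 < j)%N -> ord_pred j = j.-1 :> nat.
Proof.
move=> j0; have jn := ltn_ord j; rewrite /= -(prednK j0) addSn /=.
by rewrite modnDr modn_small //; lia.
Qed.

Lemma walk_of_steps0 l : walk_of_steps l ord0 = 0.
Proof. by rewrite ffunE big_pred0 // => j; rewrite leqn0; case: (val j). Qed.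

Lemma walk_of_stepsS l (j : 'I_n.+1) : (0 < j)%N ->
  walk_of_steps l j = walk_of_steps l (ord_pred j) + (l j + inZp (j \in S)).
Proof.
move=> j0; rewrite !ffunE (bigD1 j) /=; last by rewrite j0 leqnn.
rewrite addrC; congr (_ + _); apply: eq_bigl => i.
have -> : ((j + n.+1).-1 %% n.+1 = j.-1)%N := ord_pred_val j0.
by rewrite -val_eqE /=; lia.
Qed.

Lemma walk_stepsK g : walk_of_steps (walk_steps g) = [ffun i => g i - g ord0].
Proof.
apply/ffunP => -[i]; elim: i => [|i IH] ni.
  have -> : Ordinal ni = ord0 by apply: val_inj.
  by rewrite walk_of_steps0 ffunE subrr.
have pe : ord_pred (Ordinal ni) = Ordinal (ltnW ni).
  by apply: val_inj; apply: ord_pred_val.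
rewrite walk_of_stepsS // pe IH !ffunE pe subrK.
by rewrite addrC addrA subrK.
Qed.

(** Partial sums recover every step but the one into 0, which the divisibility of the total
    forces. *)
Lemma walk_of_stepsK (l : walk) : (r.+1 %| \sum_j l j + #|S|)%N ->
  walk_steps (walk_of_steps l) = l.
Proof.
move=> dl; apply/ffunP => j; rewrite ffunE.
case: (posnP j) => j0; last first.
  by rewrite (walk_of_stepsS l j0) [X in X - _ - _]addrC !addrK.
have -> : j = ord0 by apply: val_inj.
rewrite walk_of_steps0 sub0r -opprD; apply/eqP; rewrite eq_sym -addr_eq0; apply/eqP.
have e0 : \sum_j (l j + inZp (j \in S)) = 0.
  rewrite -[RHS](_ : inZp (\sum_j l j + #|S|)%N = 0); last first.
    by apply: val_inj => /=; apply/eqP.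
  rewrite -sum1_card [X in (_ + X)%N]big_mkcond /= -big_split inZp_sum; apply: eq_bigr => i _.
  by rewrite inZpD valZpK; case: (i \in S).
rewrite -[RHS]e0 (bigD1 ord0) //= [X in _ + (X + _)]ffunE addrCA addrC.
congr (_ + _).
apply: eq_bigl => i; rewrite /= modn_small // -[i == ord0]val_eqE /=.
by have := ltn_ord i; lia.
Qed.

Lemma card_cyclic_walks d :
  #|[set g : walk | (g ord0 == ord0) && (cyc_descents S g == d)]| =
  #|[set l : walk | (\sum_j l j + #|S| == d * r.+1)%N]|.
Proof.
rewrite -[LHS]sum1_card -[RHS]sum1_card [RHS](reindex_onto walk_steps walk_of_steps) /=.
  apply: eq_bigl => g; rewrite !inE sum_walk_steps eqn_pmul2r // andbC.
  congr andb; rewrite walk_stepsK; apply/eqP/eqP => [g0|/ffunP/(_ ord0)].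
    by apply/ffunP => i; rewrite ffunE g0 subr0.
  by rewrite ffunE subrr.
move=> l; rewrite inE => /eqP h; apply: walk_of_stepsK.
by rewrite h dvdn_mull.
Qed.

End CyclicWalks.

(** * The coefficients of the h*-polynomial *)

Definition geo (a : nat) : {poly int} := \sum_(j < a) 'X^j.

(** Modulo X^(N+1), [geo N.+1] stands for 1 / (1 - X). *)
Lemma geo_mod N a :
  in_qpoly 'X^(N.+1) (geo a) = in_qpoly 'X^(N.+1) ((1 - 'X^a) * geo N.+1).
Proof.
have E m : (1 - 'X) * geo m = 1 - 'X^m :> {poly int}.
  by rewrite -opprB mulNr -subrX1 opprB.
have -> : geo a = (1 - 'X^a) * geo N.+1 + geo a * 'X^(N.+1).
  rewrite -E [_ * geo a]mulrC -mulrA E; ring.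
by rewrite in_qpolyD [X in _ + X]in_qpolyM in_qpolyXn mulr0 addr0.
Qed.

(** This moves the factor (1 - x)^n inside the coefficient extraction, with x replaced by X^r. *)
Lemma coef_mul_comp_polyXn (p q : {poly int}) (r d : nat) : (0 < r)%N ->
  ((p \Po 'X^r) * q)`_(d * r) = \sum_(j < d.+1) p`_j * q`_((d - j) * r).
Proof.
move=> r0; pose M := maxn (size p) d.+1.
rewrite (big_ord_widen M (fun j => p`_j * q`_((d - j) * r))) ?leq_maxr //.
rewrite comp_polyE (big_ord_widen M (fun j => p`_j *: ('X^r) ^+ j)) ?leq_maxl //.
rewrite mulr_suml coef_sum [LHS]big_mkcond [RHS]big_mkcond; apply: eq_bigr => j _ /=.
have [jp|jp] := ltnP j (size p); last by rewrite nth_default // mul0r if_same.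
rewrite -scalerAl coefZ -exprM coefXnM ltnS.
rewrite [(r * j)%N]mulnC ltn_pmul2r // ltnNge; case: leqP => jd /=; rewrite ?mulr0 //.
by rewrite mulnBl.
Qed.

Lemma coef_steps_count n r s m :
  ('X^s * geo r ^+ n)`_m =
  #|[set l : {ffun 'I_n -> 'I_r} | (\sum_j l j + s == m)%N]|%:R :> int.
Proof.
rewrite -[geo r ^+ n](_ : \prod_(i < n) geo r = _); last by rewrite prodr_const card_ord.
rewrite bigA_distr_bigA mulr_sumr coef_sum.
rewrite -(sum_indicator_card _ predT); apply: eq_bigr => f _.
by rewrite -expr_sum -exprD coefXn addnC eq_sym.
Qed.

Section HstarFormula.
Variables (n k : nat) (c : 'I_n -> nat).
Hypothesis k_gt0 : (0 < k)%N.

Definition box_poly (t : nat) : {poly int} := \prod_(i < n) geo (t * c i).+1.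

(** Inclusion-exclusion over the set [S] of coordinates above their bound: each factor is (1 - X^(t
    c_i + 1)) / (1 - X) modulo X^(N+1). *)
Lemma box_poly_coef N t : (t * k <= N)%N ->
  (box_poly t)`_(t * k) = \sum_(S : {set 'I_n} | (csum c S < k)%N)
    (-1) ^+ #|S| * ('X^#|S| * geo N.+1 ^+ n)`_(t * (k - csum c S)).
Proof.
move=> tkN.
transitivity ((\prod_(i in [set: 'I_n])
    (- 'X^((t * c i).+1) + 1) * geo N.+1 ^+ n)`_(t * k)).
  apply: (@in_qpolyXn_coef _ N); last by rewrite ltnS.
  rewrite rmorph_prod (eq_bigr _ (fun i _ => geo_mod N (t * c i).+1)) -rmorph_prod.
  rewrite big_split /= prodr_const card_ord; congr (in_qpoly _ (_ * _)).
  by apply: eq_big => [i|i _]; rewrite ?inE // addrC.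
rewrite prod_add_in mulr_suml coef_sum [RHS]big_mkcond.
apply: eq_big => [S|S _]; first by rewrite subsetT.
rewrite big1_eq mulr1 prodrN -expr_sum.
have -> : (\sum_(i in S) (t * c i).+1 = t * csum c S + #|S|)%N.
  by rewrite -sum1_card /csum big_distrr -big_split /=; apply: eq_bigr => i _; rewrite addn1.
rewrite -mulrA -signr_odd.
have -> (p : {poly int}) m : ((-1) ^+ odd #|S| * p)`_m = (-1) ^+ odd #|S| * p`_m.
  by case: (odd _); rewrite ?expr0 ?mul1r // !expr1 !mulN1r coefN.
rewrite signr_odd !coefXnM; case: (ltnP (csum c S) k) => Sk; last first.
  (* If c(S) >= k > 0 then [S] is nonempty, so the shift t c(S) + |S| exceeds t k. *)
  rewrite ifT ?mulr0 // (leq_ltn_trans (leq_mul (leqnn t) Sk)) // -[X in (X < _)%N]addn0.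
  rewrite ltn_add2l card_gt0; apply: contraTneq Sk => ->.
  by rewrite /csum big_set0 -ltnNge.
by rewrite subnDA mulnBr ltn_subLR // leq_mul2l ltnW ?orbT.
Qed.

(** For fixed [S] and r = k - c(S), the factor (1 - X^r)^n turns 1 / (1 - X)^n into the power of 1 +
    ... + X^(r-1) that counts sequences of steps. *)
Lemma hstar_formula d :
  \sum_(j < d.+1) ((1 - 'X : {poly int}) ^+ n)`_j * (box_poly (d - j))`_((d - j) * k)
  = \sum_(S : {set 'I_n} | (csum c S < k)%N) (-1) ^+ #|S| *
    #|[set l : {ffun 'I_n -> 'I_(k - csum c S)} |
        (\sum_j l j + #|S| == d * (k - csum c S))%N]|%:R.
Proof.
under eq_bigr => j _.
  rewrite (@box_poly_coef (d * k)) ?leq_mul2r ?leq_subr ?orbT // mulr_sumr; over.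
rewrite exchange_big /=; apply: eq_bigr => S Sk.
under eq_bigr do rewrite mulrCA.
rewrite -mulr_sumr -coef_mul_comp_polyXn ?subn_gt0 //; congr (_ * _).
rewrite -coef_steps_count; apply: (@in_qpolyXn_coef _ (d * k)); last first.
  by rewrite ltnS leq_mul2l leq_subr orbT.
rewrite (rmorphXn (comp_poly _)) rmorphB rmorph1 /= comp_polyX.
rewrite mulrCA -exprMn !in_qpolyM !(rmorphXn (in_qpoly _)); congr (_ * _ ^+ _).
by rewrite /= -geo_mod.
Qed.

End HstarFormula.

Lemma hstar_rooted_count n k (c : 'I_n.+1 -> nat) d :
  (forall i, (0 < c i)%N) -> (0 < k)%N -> (k < \sum_i c i)%N ->
  \sum_(j < d.+1) ((1 - 'X : {poly int}) ^+ n.+1)`_j *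
     (box_poly c (d - j))`_((d - j) * k) =
  \sum_(m < n.+2) #|[set s : m.+1.-tuple (weighted_block n.+1 k) |
     rooted_compatible c ord0 s &&
      ((\sum_(b <- s) b.2 == k)%N && (ostat (map fst s) == d))]|%:R.
Proof.
move=> c0 k0 kc; rewrite hstar_formula // rooted_compatible_count //.
apply: eq_bigr => S Sk; rewrite card_cyclic_walks.
by rewrite -[in LHS](prednK (_ : (0 < k - csum c S)%N)) ?subn_gt0.
Qed.

Local Open Scope nat_scope.

(** * Rotation classes of decorated partitions *)

Lemma opart_size n (B : {set 'I_n}) t :
  opart B t -> all (fun T : {set 'I_n} => T != set0) t -> size t <= #|B|.
Proof.
elim: t B => [//|T t IH] B /= /andP[TB tB] /andP[T0 t0].
have := IH _ tB t0; rewrite cardsD (setIidPr TB).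
move: (subset_leq_card TB) T0; rewrite -card_gt0.
by move: #|B| #|T| => b u; lia.
Qed.

Lemma card_bseq_sum N (T : finType) (P : pred (seq T)) :
  #|[set s : N.-bseq T | P s]| = \sum_(m < N.+1) #|[set s : m.-tuple T | P s]|.
Proof.
rewrite -sum1_card (reindex _ (onW_bij _ (@tagged_tuple_bseq_bij N T))) /=.
rewrite (eq_bigl (fun u : {m : 'I_N.+1 & m.-tuple T} => P (tagged u))); last first.
  by move=> [m s]; rewrite inE.
rewrite (eq_bigr (fun m : 'I_N.+1 => \sum_(s : m.-tuple T | P s) 1)); last first.
  by move=> m _; rewrite -sum1_card; apply: eq_bigl => s; rewrite inE.
by rewrite [RHS]sig_big_dep.
Qed.

Section Rotation.
Variables (T : eqType).
Implicit Type s : seq T.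

Lemma rot_rot_ex i j s : exists l, rot j (rot i s) = rot l s.
Proof.
rewrite (rot_minn i s) (rot_minn j) size_rot.
set a := minn i _; set b := minn j _.
rewrite rot_add_mod ?geq_minr //.
case: ifP => h; first by exists (b + a).
by exists (b + a - size s).
Qed.

Lemma rot_back i s : exists l, rot l (rot i s) = s.
Proof.
exists (size s - minn i (size s)).
by have := rotK (minn i (size s)) s; rewrite /rotr size_rot -(rot_minn i).
Qed.

End Rotation.

Section DecoratedPartitions.
Variables (n k : nat) (o : 'I_n).
Hypothesis k_gt0 : 0 < k.
Local Notation X := (weighted_block n k).
Local Notation WB := (weighted_blocks n k).

(** [is_decorated_partition] on sequences without a length bound, since [rot] returns a plain
    sequence. *)
Definition decorated (s : seq X) : bool :=
  [&& all (fun b : X => b.1 != set0) s,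
      pairwise (fun b b' : X => [disjoint b.1 & b'.1]) s,
      \bigcup_(b <- s) b.1 == [set: 'I_n],
      all (fun b : X => 0 < b.2) s & \sum_(b <- s) b.2 == k].

Definition find_block (s : seq X) (i : 'I_n) : nat := find (fun b : X => i \in b.1) s.

Definition prefix_weight (s : seq X) (i : 'I_n) : nat :=
  \sum_(b <- take (find_block s i) s) b.2.

Lemma decorated_opart s : decorated s -> opart setT (map fst s).
Proof.
case/and5P => _ dis /eqP cov _ _; rewrite opartE pairwise_map dis /=.
by rewrite big_map cov.
Qed.

Lemma find_blockE s i : find_block s i = block_index (map fst s) i.
Proof. by rewrite /block_index find_map. Qed.

Lemma find_block_lt s i : decorated s -> find_block s i < size s.
Proof.
move=> /decorated_opart ds; rewrite find_blockE -(size_map fst s).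
by rewrite (block_index_lt i ds) inE.
Qed.

Lemma prefix_mono (s : seq X) a b : all (fun b : X => 0 < b.2) s ->
  a < b <= size s -> \sum_(b <- take a s) b.2 < \sum_(b <- take b s) b.2.
Proof.
elim: s a b => [|y s IH] a b /=; first by move=> _; lia.
case: a b => [|a] [|b] /andP[y0 s0] h //.
  by rewrite big_nil big_cons; lia.
by rewrite /= !big_cons ltn_add2l; apply: IH.
Qed.

Lemma prefix_weight_lt s i : decorated s -> prefix_weight s i < k.
Proof.
move=> ds; have lt := find_block_lt i ds.
case/and5P: ds => _ _ _ pos /eqP <-.
by rewrite -[X in _ < \sum_(b <- X) _](take_size s) prefix_mono ?lt /=.
Qed.

Lemma prefix_weight_ltE s i j : decorated s ->
  (prefix_weight s i < prefix_weight s j) = (find_block s i < find_block s j).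
Proof.
move=> ds; have lti := find_block_lt i ds; have ltj := find_block_lt j ds.
case/and5P: ds => _ _ _ pos _; rewrite /prefix_weight.
case: (ltngtP (find_block s i) (find_block s j)) => h.
- by apply: prefix_mono => //; rewrite h ltnW.
- by apply/negbTE; rewrite -leqNgt ltnW //; apply: prefix_mono => //; rewrite h ltnW.
- by rewrite h ltnn.
Qed.

Lemma posE (s : WB) i : decorated s -> pos s i = prefix_weight s i.
Proof. by move=> ds; rewrite /pos modn_small // prefix_weight_lt. Qed.

(** A distance is a difference of positions, plus [k] exactly when the block of i + 1 precedes that
    of i; the differences cancel around the cycle. *)
Lemma sum_clockwise_dist (s : WB) : decorated s ->
  \sum_(i < n) clockwise_dist s i = ostat (map fst s) * k.
Proof.
move=> ds; apply/eqP; rewrite -(eqn_add2r (\sum_(i < n) prefix_weight s i)).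
rewrite -big_split /= (ostat_setT (decorated_opart ds)).
rewrite (eq_bigr (fun i => prefix_weight s (ordS i) +
   (block_index (map fst s) (ordS i) < block_index (map fst s) i) * k)); last first.
  move=> i _; rewrite /clockwise_dist !posE // -!find_blockE -prefix_weight_ltE //.
  have := prefix_weight_lt i ds; have := prefix_weight_lt (ordS i) ds.
  move: (prefix_weight s (ordS i)) (prefix_weight s i) => a b ak bk.
  case: (ltnP a b) => h; first by rewrite modn_small; lia.
  by rewrite -addnBAC // modnDr modn_small; lia.
rewrite big_split /= -big_distrl addnC /=; apply/eqP; congr addn.
by rewrite [RHS](reindex_inj (@ordS_inj n)).
Qed.

Lemma winding_ostat (s : WB) d : decorated s ->
  seq_has_winding d s = (ostat (map fst s) == d).
Proof. by move=> ds; rewrite /seq_has_winding sum_clockwise_dist // eqn_pmul2r. Qed.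

Lemma decorated_rot j s : decorated s -> decorated (rot j s).
Proof.
have ss' : perm_eq s (rot j s) by rewrite perm_sym perm_rot.
move=> /and5P[h1 h2 h3 h4 h5]; apply/and5P; split.
- by rewrite -(perm_all _ ss').
- move: h2; rewrite -{1}(cat_take_drop j s) /rot !pairwise_cat.
  rewrite allrelC => /and3P[h ha hb]; rewrite ha hb !andbT.
  by rewrite -(eq_allrel (fun x y => disjoint_sym _ _)).
- by rewrite -(perm_big _ ss').
- by rewrite -(perm_all _ ss').
- by rewrite -(perm_big _ ss').
Qed.

Lemma prefix_weight_cat s s' i : prefix_weight (s ++ s') i =
  if has (fun b : X => i \in b.1) s then prefix_weight s i
  else \sum_(b <- s) b.2 + prefix_weight s' i.
Proof.
rewrite /prefix_weight /find_block find_cat take_cat.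
case: (boolP (has _ s)) => hs; first by rewrite -has_find hs.
by rewrite ltnNge leq_addr /= addKn big_cat.
Qed.

(** All positions drop by the weight of the moved blocks, and those of the moved blocks also gain
    the total weight [k]. *)
Lemma prefix_weight_rot j s i : decorated s ->
  prefix_weight (rot j s) i + \sum_(b <- take j s) b.2 = prefix_weight s i %[mod k].
Proof.
move=> ds; rewrite /rot.
have hs : has (fun b : X => i \in b.1) s by rewrite has_find find_block_lt.
have sk : \sum_(b <- take j s) b.2 + \sum_(b <- drop j s) b.2 = k.
  by rewrite -big_cat cat_take_drop; case/and5P: ds => _ _ _ _ /eqP.
have dis : ~~ (has (fun b : X => i \in b.1) (take j s) &&
               has (fun b : X => i \in b.1) (drop j s)).
  case/and5P: ds => _; rewrite -{1}(cat_take_drop j s) pairwise_cat => /andP[/allrelP h _] _ _ _.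
  apply/negP => /andP[/hasP[b bs ib] /hasP[b' bs' ib']].
  by have := disjointFr (h _ _ bs bs') ib; rewrite ib'.
rewrite -{1}(cat_take_drop j s) has_cat in hs.
rewrite -[in RHS](cat_take_drop j s) !prefix_weight_cat.
case: (boolP (has _ (take j s))) hs dis => /= ha hs dis.
  by rewrite (negPf dis) addnAC [X in X + _]addnC sk modnDl.
by rewrite hs addnC.
Qed.

(** Rotation shifts all positions alike modulo [k], so it keeps every clockwise distance and hence
    their sum. *)
Lemma ostat_rot j (s : WB) (s' : WB) : decorated s -> rot j s = s' ->
  ostat (map fst s') = ostat (map fst s).
Proof.
move=> ds rs; have ds' : decorated s' by rewrite -rs decorated_rot.
apply/eqP; rewrite -(eqn_pmul2r k_gt0) -!sum_clockwise_dist //; apply/eqP.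
apply: eq_bigr => i _; rewrite /clockwise_dist !posE //.
set P := \sum_(b <- take j s) b.2.
have e i' : prefix_weight s' i' + P = prefix_weight s i' %[mod k].
  by rewrite -rs prefix_weight_rot.
have l1 := prefix_weight_lt i ds; have l2 := prefix_weight_lt i ds'.
apply/eqP; rewrite -(eqn_modDr (prefix_weight s i)) subnK; last by lia.
move: (e i) (e (ordS i)) l1 l2.
move: (prefix_weight _ _) (prefix_weight _ _) (prefix_weight _ _) (prefix_weight _ _).
move=> a a' b b' eb ea bk b'k.
have -> : (a' + k - b' + b) %% k = (a' + k - b' + (b' + P)) %% k.
  by rewrite -modnDmr -eb modnDmr.
by rewrite -[X in _ == X]modnDml -ea modnDml; apply/eqP; congr (_ %% _); lia.
Qed.

Section RootedClasses.
Variables (c : 'I_n -> nat) (d : nat).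

Definition root_class (s : WB) : {set WB} :=
  [set s' : WB | decorated s' & rot_equiv s s'].

Definition rooted : {set WB} :=
  [set s : WB | [&& decorated s, ohead_sat (fun b : X => o \in b.1) s,
     seq_compatible c s & seq_has_winding d s]].

Lemma rot_equivP (s s' : WB) : reflect (exists j, rot j s = s') (rot_equiv s s').
Proof.
apply: (iffP existsP) => [[j /eqP h]|[j h]]; first by exists j.
(* Rotating by at least the length does nothing, and the length is at most [n]. *)
have jn : minn j (size s) < n.+1.
  by rewrite ltnS (leq_trans (geq_minr _ _)) // size_bseq.
by exists (Ordinal jn); rewrite /= -rot_minn h.
Qed.

Lemma rot_equiv_refl (s : WB) : rot_equiv s s.
Proof. by apply/rot_equivP; exists 0; rewrite rot0. Qed.

Lemma root_class_rot j (s s' : WB) : rot j s = s' -> root_class s = root_class s'.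
Proof.
move=> ss'; apply/setP => y; rewrite !inE; congr andb.
apply/rot_equivP/rot_equivP => -[i h].
  have [l hl] := rot_back j s; rewrite -h -hl ss'.
  by have [l' ->] := rot_rot_ex l i s'; exists l'.
by rewrite -h -ss'; have [l ->] := rot_rot_ex j i s; exists l.
Qed.

(* Rotating the block of [o] to the front picks one representative per class. *)
Lemma rooted_unique (s s' : WB) : decorated s ->
  ohead_sat (fun b : X => o \in b.1) s -> ohead_sat (fun b : X => o \in b.1) s' ->
  rot_equiv s s' -> s = s'.
Proof.
move=> ds hs hs' /rot_equivP[j rs]; apply: val_inj.
rewrite /= -rs; case: (leqP (size s) j) => js; first by rewrite rot_oversize.
have find0 : find_block s o = 0.
  rewrite /find_block; move: hs (find_block_lt o ds); rewrite /find_block.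
  by case: (bseqval s) => //= b t ->.
have : find_block s o == j.
  rewrite find_blockE -(mem_block _ (decorated_opart ds)) ?size_map //.
  rewrite (nth_map (set0, ord0)) //; move: hs'; rewrite -rs /rot.
  by rewrite (drop_nth (set0, ord0)).
by rewrite find0 => /eqP <-; rewrite rot0.
Qed.

Lemma card_rooted_classes :
  #|[set Y in dosps n k | compatible c Y && has_winding d Y]| = #|rooted|.
Proof.
have inj : {in rooted &, injective root_class}.
  move=> s s'; rewrite !inE => /and4P[ds hs _ _] /and4P[ds' hs' _ _] e.
  have : s' \in root_class s by rewrite e inE ds' rot_equiv_refl.
  by rewrite inE => /andP[_]; apply: rooted_unique.
rewrite -(card_in_imset inj); apply: eq_card => Y; rewrite inE.
apply/andP/imsetP => [[/imsetP[s sD ->] /andP[/forall_inP co /forall_inP wi]]|[s]].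
  rewrite inE in sD; have fl := find_block_lt o sD.
  have rsz : size (rot (find_block s o) s) <= n by rewrite size_rot size_bseq.
  (* The representative that starts with the block of [o]. *)
  pose s' : WB := Bseq rsz.
  have e : [set y in [set s0 | is_decorated_partition s0] | rot_equiv s y] = root_class s.
    by apply/setP => y; rewrite !inE.
  have s's : s' \in root_class s.
    by rewrite inE decorated_rot //=; apply/rot_equivP; exists (find_block s o).
  exists s'; last by rewrite e; apply: (@root_class_rot (find_block s o)).
  rewrite !inE co ?wi ?e // decorated_rot //= !andbT.
  rewrite /rot (drop_nth (set0, ord0)) //=.
  by apply: (@nth_find _ _ (fun b : X => o \in b.1)); rewrite has_find.
rewrite inE => /and4P[ds hs co wi] ->; split.
  apply/imsetP; exists s; first by rewrite inE.
  by apply/setP => y; rewrite !inE.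
apply/andP; split; apply/forall_inP => s'; rewrite inE => /andP[ds' /rot_equivP[j rs]].
  by rewrite /seq_compatible -rs (perm_all _ (_ : perm_eq _ s)) // perm_rot.
by rewrite winding_ostat // (ostat_rot ds rs) -winding_ostat.
Qed.

Lemma rootedE (s : WB) : (s \in rooted) = rooted_compatible c o s &&
  ((\sum_(b <- s) b.2 == k) && (ostat (map fst s) == d)).
Proof.
rewrite inE /rooted_compatible opartE pairwise_map big_map.
case: (boolP (decorated s)) => ds /=.
  rewrite winding_ostat //; case/and5P: ds => _ -> -> p ->.
  rewrite (eq_all (a2 := predI (fun b : X => 0 < b.2)
    (fun b : X => b.2 < csum c b.1))); last by [].
  by rewrite all_predI p /= andbA.
apply/esym/negP; rewrite -!andbA => /and5P[dis cov _ al /andP[sk _]].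
case/negP: ds; apply/and5P; split=> //; apply/allP => b /(allP al) /andP[] //.
by move=> _; apply: contraTneq => ->; rewrite /csum big_set0.
Qed.

Lemma card_dosps_rooted :
  #|[set Y in dosps n k | compatible c Y && has_winding d Y]| =
  \sum_(m < n.+1) #|[set s : m.+1.-tuple X | rooted_compatible c o s &&
      ((\sum_(b <- s) b.2 == k) && (ostat (map fst s) == d))]|.
Proof.
pose Q (s : seq X) := rooted_compatible c o s &&
  ((\sum_(b <- s) b.2 == k) && (ostat (map fst s) == d)).
rewrite card_rooted_classes (_ : rooted = [set s : WB | Q s]); last first.
  by apply/setP => s; rewrite rootedE inE.
(* Lengths run over 0..n on the left and 1..n+1 on the right; length 0 does not cover [o], and n + 1
   nonempty disjoint blocks do not fit. *)
rewrite card_bseq_sum big_ord_recl big_ord_recr /=.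
rewrite [X in X + _](_ : _ = 0); last first.
  apply/eqP; rewrite cards_eq0; apply/eqP/setP => s; rewrite !inE tuple0 /Q.
  rewrite /rooted_compatible /=; case: eqP => // /setP/(_ o); by rewrite !inE.
rewrite add0n [X in _ + X](_ : _ = 0) ?addn0 //.
apply/eqP; rewrite cards_eq0; apply/eqP/setP => s; rewrite !inE.
apply/negP => /andP[/and3P[op _ al] _].
have := opart_size op; rewrite size_map size_tuple cardsT card_ord ltnn => h.
suff : false by []; apply: h; rewrite all_map; apply/allP => b /(allP al) /= /andP[_].
by apply: contraTneq => ->; rewrite /csum big_set0.
Qed.

End RootedClasses.

End DecoratedPartitions.

Local Open Scope ring_scope.

(** * Lattice points and dimension of the polytope *)

Lemma box_poly_count n (c : 'I_n -> nat) t N m :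
  (forall i, (t * c i < N)%N) ->
  (box_poly c t)`_m = #|[set f : {ffun 'I_n -> 'I_N} |
     [forall i, (f i <= t * c i)%N] && (\sum_i f i == m)%N]|%:R :> int.
Proof.
move=> cN; rewrite /box_poly /geo.
rewrite (eq_bigr (fun i => \sum_(j < N | (j <= t * c i)%N) 'X^j)); last first.
  by move=> i _; rewrite (big_ord_widen N (fun j => 'X^j)).
rewrite (bigA_distr_big_dep (fun i j : 'I__ => (j <= t * c i)%N)) coef_sum.
rewrite -(sum_indicator_card _ (fun f : {ffun 'I_n -> 'I_N} => [forall i, (f i <= t * c i)%N])).
apply: eq_big => [f|f _]; first exact: eq_forallb.
by rewrite -expr_sum coefXn eq_sym.
Qed.

From mathcomp Require Import boolp classical_sets cardinality reals.

Section LatticePoints.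
Variables (R : realType) (n k t : nat) (c : 'I_n -> nat).
Hypothesis t_gt0 : (0 < t)%N.

Lemma lattice_points_Rkc (z : 'rV[int]_n) :
  lattice_points (dilate t (@Rkc R n k c)) z <->
  (forall i, 0 <= z 0 i <= (t * c i)%:Z) /\ \sum_i z 0 i = (t * k)%:Z.
Proof.
have t0 : 0 < t%:R :> R by rewrite ltr0n.
have tn0 : t%:R != 0 :> R by rewrite gt_eqF.
rewrite /lattice_points /dilate /=; split=> [[x [xb xs] e]|[zb zs]].
  have ez i : (z 0 i)%:~R = t%:R * x 0 i :> R.
    by have := congr1 (fun v : 'rV[R]_n => v 0 i) e; rewrite !mxE => <-.
  split=> [i|].
    have /andP[x0 xc] := xb i.
    rewrite -(ler0z R) -(ler_int R) ez mulr_ge0 ?ler0n //=.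
    by rewrite -pmulrn natrM ler_pM2l.
  apply/eqP; rewrite -(eqr_int R) -pmulrn natrM -xs mulr_sumr rmorph_sum /=.
  by apply/eqP; apply: eq_bigr => i _; rewrite ez.
exists (\row_i ((z 0 i)%:~R / t%:R)).
  split=> [i|].
    have /andP[z0 zc] := zb i.
    rewrite mxE divr_ge0 ?ler0z ?ler0n //= ler_pdivrMr //.
    by rewrite -natrM pmulrn ler_int mulnC.
  under eq_bigr do rewrite mxE.
  rewrite -mulr_suml -(rmorph_sum (intr : int -> R)) zs /=.
  by rewrite -pmulrn natrM mulrAC mulfV // mul1r.
by apply/rowP => i; rewrite !mxE mulrCA mulfV // mulr1.
Qed.

Definition lattice_row N (f : {ffun 'I_n -> 'I_N}) : 'rV[int]_n :=
  \row_i (f i : nat)%:Z.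

Lemma lattice_row_inj N : injective (@lattice_row N).
Proof.
move=> f g /rowP e; apply/ffunP => i; apply: val_inj.
by have := e i; rewrite !mxE => -[].
Qed.

Lemma ehr_Rkc_pos : (ehr (@Rkc R n k c) t)%:R = (box_poly c t)`_(t * k) :> int.
Proof.
pose N := (t * \sum_i c i).+1.
have cN i : (t * c i < N)%N by rewrite ltnS leq_mul2l (bigD1 i) //= leq_addr orbT.
rewrite (box_poly_count _ cN) /ehr gtn_eqF //; set A := finset.finset _.
congr (_%:R); pose F := [fset lattice_row f | f in A]%fset.
suff -> : lattice_points (dilate t (@Rkc R n k c)) = [set` F]%classic.
  rewrite set_fsetK card_imfset /=; last exact: lattice_row_inj.
  by rewrite cardE.
apply/predeqP => z; rewrite lattice_points_Rkc /=; split=> [[zb zs]|].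
  have zi i : z 0 i = absz (z 0 i) by rewrite gez0_abs //; have /andP[] := zb i.
  have ziN i : (absz (z 0%R i) < N)%N.
    apply: leq_ltn_trans (cN i); have /andP[_] := zb i.
    by rewrite {1}zi lez_nat.
  apply/imfsetP; exists [ffun i => inord (absz (z 0 i))]; last first.
    by apply/rowP => i; rewrite !mxE ffunE inordK.
  rewrite /= inE; apply/andP; split.
    by apply/forallP => i; rewrite ffunE inordK // -lez_nat -zi; have /andP[] := zb i.
  rewrite -eqz_nat -zs (raddf_sum Posz) /=; apply/eqP; apply: eq_bigr => i _.
  by rewrite ffunE inordK // -zi.
case/imfsetP => f /=; rewrite inE => /andP[/forallP fb /eqP fs] ->; split=> [i|].
  by rewrite mxE lez_nat fb.
by rewrite -fs (raddf_sum Posz) /=; apply: eq_bigr => i _; rewrite mxE.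
Qed.

End LatticePoints.

Lemma ehr_Rkc (R : realType) n k t (c : 'I_n -> nat) :
  (ehr (@Rkc R n k c) t)%:R = (box_poly c t)`_(t * k) :> int.
Proof.
case: (posnP t) => [->|]; last exact: ehr_Rkc_pos.
rewrite /ehr eqxx mul0n /box_poly big1 ?coef1 // => i _.
by rewrite mul0n /geo big_ord1.
Qed.

Section Dimension.
Variables (R : realType) (n k : nat) (c : 'I_n.+1 -> nat).
Hypotheses (c_gt0 : forall i, (0 < c i)%N) (k_gt0 : (0 < k)%N).
Hypothesis k_lt : (k < \sum_i c i)%N.

(** Edge vectors have coordinate sum 0, so an invertible matrix of edges would annihilate the
    all-ones vector. *)
Lemma Rkc_no_full_simplex : ~ contains_simplex (@Rkc R n.+1 k c) n.+1.
Proof.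
case=> x [M [[_ xs] hM /row_freeP]] [B MB].
have M1 : M *m const_mx 1 = 0 :> 'cV_n.+1.
  apply/colP => i; rewrite !mxE.
  have [_] := hM i; under eq_bigr do rewrite mxE.
  rewrite big_split /= xs => /eqP; rewrite -subr_eq0 addrAC subrr add0r => /eqP e.
  by rewrite -[RHS]e; apply: eq_bigr => j _; rewrite !mxE mulr1.
have BM := mulmx1C MB.
have : const_mx 1 = 0 :> 'cV[R]_n.+1.
  by rewrite -[LHS]mul1mx -BM -mulmxA M1 mulmx0.
by move/colP/(_ ord0); rewrite !mxE => /eqP; rewrite oner_eq0.
Qed.

(* The point [k c / C], with [C] the sum of the [c_i], has all its coordinates at
   distance at least [1 / C] from the bounds. *)
Lemma Rkc_simplex : contains_simplex (@Rkc R n.+1 k c) n.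
Proof.
pose C : R := (\sum_i c i)%:R.
have C0 : 0 < C by rewrite ltr0n (leq_ltn_trans _ k_lt).
have Cn0 : C != 0 by rewrite gt_eqF.
have Ci : 0 <= C^-1 by rewrite invr_ge0 ltW.
pose x : 'rV[R]_n.+1 := \row_i (k%:R * (c i)%:R / C).
have xs : \sum_i x 0 i = k%:R.
  under eq_bigr do rewrite mxE -mulrA mulrC -mulrA.
  by rewrite -mulr_suml -natr_sum -/C mulrA mulfV // mul1r.
have xlo i : C^-1 <= x 0 i.
  by rewrite mxE -[X in X <= _]mul1r ler_pM2r ?invr_gt0 // -natrM ler1n muln_gt0 k_gt0 c_gt0.
have xhi i : x 0 i <= (c i)%:R - C^-1.
  rewrite mxE ler_pdivrMr // mulrBl mulVf // lerBrDr /C -!natrM -[X in _ + X]/(1%:R) -natrD ler_nat.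
  by rewrite [(c i * _)%N]mulnC; have := c_gt0 i; move: k_lt; nia.
(* The edges (e_(i+1) - e_0) / C keep the coordinate sum and move coordinates by at most 1 / C. *)
pose M : 'M[R]_(n, n.+1) :=
  \matrix_(i, j) (C^-1 * ((j == lift ord0 i)%:R - (j == ord0)%:R)).
exists x, M; split.
- split=> // i; have := xlo i; have := xhi i.
  by move: (x 0 i) C^-1 Ci => y e; lra.
- move=> i; split=> [j|].
    rewrite !mxE -[X in X + _](_ : x 0 j = _); last by rewrite mxE.
    have := xlo j; have := xhi j.
    have jd : (j == lift ord0 i) && (j == ord0) = false.
      by apply/negP => /andP[/eqP ->].
    case: (j == lift _ _) jd; case: (j == ord0) => //= _; move: (x 0 j) C^-1 Ci => y e; lra.
  under eq_bigr do rewrite mxE.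
  rewrite big_split /= xs -[RHS]addr0; congr (_ + _).
  under eq_bigr do rewrite !mxE.
  rewrite -mulr_sumr sumrB (bigD1 (lift ord0 i)) //= eqxx big1 => [|j /negPf -> //].
  by rewrite (bigD1 ord0) //= big1 ?addr0 ?subrr ?mulr0 // => j /negPf ->.
(* The right inverse forgets coordinate 0 and multiplies by [C]. *)
- apply/row_freeP; exists (\matrix_(j, l) (C * (j == lift ord0 l)%:R)).
  apply/matrixP => i l; rewrite !mxE (bigD1 (lift ord0 l)) //= big1 => [|j /negPf jl].
    rewrite !mxE eqxx mulr1 addr0 mulrAC mulVf // mul1r subr0.
    by rewrite (inj_eq lift_inj) eq_sym.
  by rewrite !mxE jl !mulr0.
Qed.

Lemma polytope_dim_Rkc : polytope_dim (@Rkc R n.+1 k c) = n.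
Proof.
apply/eqP; rewrite eqn_leq; apply/andP; split.
  apply/bigmax_leqP => d /asboolP hd; have := ltn_ord d; rewrite ltnS leq_eqVlt.
  case/orP => [/eqP e|]; last by rewrite ltnS.
  by rewrite e in hd; case: (Rkc_no_full_simplex hd).
have nn : (n < n.+2)%N by [].
by apply: (leq_bigmax_cond (Ordinal nn)); apply/asboolP; exact: Rkc_simplex.
Qed.

End Dimension.

(** * Identification of [hstar] *)

Section Hstar.
Variables (R : realType) (n k : nat) (c : 'I_n.+1 -> nat).
Hypotheses (c_gt0 : forall i, (0 < c i)%N) (k_gt0 : (0 < k)%N).
Hypothesis k_lt : (k < \sum_i c i)%N.

Definition dosp_count d : nat :=
  #|[set Y in dosps n.+1 k | compatible c Y && has_winding d Y]|.

Lemma dosp_count_series d :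
  \sum_(j < d.+1) ((1 - 'X : {poly int}) ^+ n.+1)`_j *
     (ehr (@Rkc R n.+1 k c) (d - j))%:R = (dosp_count d)%:R.
Proof.
under eq_bigr do rewrite ehr_Rkc.
by rewrite hstar_rooted_count // /dosp_count (card_dosps_rooted ord0 k_gt0) natr_sum.
Qed.

(** A winding number counts cyclic descents on n + 1 points. This bound makes the series of counts a
    polynomial. *)
Lemma dosp_count_eq0 d : (n.+1 < d)%N -> dosp_count d = 0%N.
Proof.
move=> nd; rewrite /dosp_count (card_dosps_rooted ord0 k_gt0) big1 // => m _.
apply: eq_card0 => s; rewrite inE; apply/negP.
case/andP => /and3P[op _ _] /andP[_ /eqP e].
move: nd; rewrite -e (ostat_setT op) ltnNge => /negP; apply.
rewrite -[X in (_ <= X)%N]card_ord -sum1_card; apply: leq_sum => i _.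
exact: leq_b1.
Qed.

Lemma is_hstarP (h : {poly int}) :
  is_hstar (@Rkc R n.+1 k c) h <-> (forall d, h`_d = (dosp_count d)%:R).
Proof.
have coefE N d : (d < N)%N ->
    (take_poly N ((1 - 'X) ^+ (polytope_dim (@Rkc R n.+1 k c)).+1 *
       \poly_(j < N) (ehr (@Rkc R n.+1 k c) j)%:R))`_d = (dosp_count d)%:R :> int.
  move=> dN; rewrite coef_take_poly dN polytope_dim_Rkc // coefM -dosp_count_series.
  by apply: eq_bigr => j _; rewrite coef_poly (leq_ltn_trans (leq_subr _ _) dN).
split=> [hP d|hP N].
  have := congr1 (fun p : {poly int} => p`_d) (hP d.+1); rewrite coefE //.
  by rewrite coef_take_poly ltnSn => ->.
apply/polyP => d; case: (ltnP d N) => dN.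
  by rewrite coefE // coef_take_poly dN hP.
by rewrite !coef_take_poly ltnNge dN.
Qed.

Lemma hstar_coef d : (hstar (@Rkc R n.+1 k c))`_d = (dosp_count d)%:R.
Proof.
suff : is_hstar (@Rkc R n.+1 k c) (hstar (@Rkc R n.+1 k c)) by move/is_hstarP.
(* A witness is needed to exclude the default value 0 of [xget]. *)
apply: xgetPex; exists (\poly_(d < n.+2) (dosp_count d)%:R); apply/is_hstarP => e.
by rewrite coef_poly ltnNge; case: leqP => // /dosp_count_eq0 ->.
Qed.

End Hstar.

Theorem theorem1p7 (R : realType) (n k : nat) (c : 'I_n -> nat)
    (c_gt0 : forall i : 'I_n, (0 < c i)%N)
    (k_gt0 : (0 < k)%N)
    (k_lt : (k < \sum_(i < n) c i)%N) :
  forall i : nat, (i <= n)%N ->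
    ((hstar (@Rkc R n k c))`_i)%R =
    (#|[set X in dosps n k | compatible c X && has_winding i X]|%:R)%R.
Proof.
move=> i _; case: n c c_gt0 k_lt => [|n] c c_gt0 k_lt.
  by rewrite big_ord0 in k_lt.
exact: hstar_coef.
Qed.
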